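(* Let $p \geq 5$ be a prime number. Let $K$ be any number field with $[K:\mathbb{Q}] = 3p$, and let $E: y^2 = x^3 + c$ be a Mordell curve, where $c \in \mathbb{Q}$ is a nonzero sixth-power-free element. Then $E(K)_{\text{tors}}$ is isomorphic to one of $C_1, C_2, C_3, C_6, C_9$. Moreover, each of these groups occurs: the set $\Phi^M_{\mathbb{Q}}(3p)$ of all groups (up to isomorphism) arising as $E(K)_{\text{tors}}$ for a number field $K$ of degree $3p$ and a Mordell curve $E$ defined over $\mathbb{Q}$ is exactly $$\Phi^M_{\mathbb{Q}}(3p) = \{ C_m : m = 1,2,3,6,9\}.$$
   Context: A Mordell curve over a field $F$ is an elliptic curve of the form $y^2 = x^3 + c$ with $c \in F$, $c \neq 0$. For an elliptic curve $E$ over a number field $K$, $E(K)_{\text{tors}}$ denotes the torsion subgroup of the Mordell–Weil group $E(K)$. $C_n$ denotes the cyclic group of order $n$ ($C_1$ the trivial group). *)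

(* Defs.v *)
From HB Require Import structures.
From mathcomp Require Import all_boot all_order all_algebra all_field.
From mathcomp Require Import ring.

Set Implicit Arguments.
Unset Strict Implicit.
Unset Printing Implicit Defensive.

Import GRing.Theory.
Local Open Scope ring_scope.

Section MordellCurve.

Variables (F : fieldType) (c : F).

(* [None] is the point at infinity. *)
Definition on_mordell (P : option (F * F)) : bool :=
  if P is Some (x, y) then y ^+ 2 == x ^+ 3 + c else true.

Record mordell : predArgType :=
  Mordell { mordell_val :> option (F * F); _ : on_mordell mordell_val }.

HB.instance Definition _ := [isSub for mordell_val].
HB.instance Definition _ := [Choice of mordell by <:].

Definition mordell_zero : mordell := @Mordell None isT.

(* The chord-and-tangent law. *)
Definition slope (x1 y1 x2 y2 : F) : F :=
  if x1 == x2 then (x1 ^+ 2 *+ 3) / (y1 *+ 2) else (y2 - y1) / (x2 - x1).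

Definition raw_add (P Q : option (F * F)) : option (F * F) :=
  match P, Q with
  | None, _ => Q
  | _, None => P
  | Some (x1, y1), Some (x2, y2) =>
      if (x1 == x2) && (y1 == - y2) then None else
      let s := slope x1 y1 x2 y2 in
      let x3 := s ^+ 2 - x1 - x2 in
      Some (x3, s * (x1 - x3) - y1)
  end.

Lemma raw_add_on (P Q : mordell) : on_mordell (raw_add P Q).
Proof.
case: P Q => [[[x1 y1]|] //= h1] [[[x2 y2]|] //= h2].
case: ifPn => //=; rewrite /slope.
have e1 := eqP h1; have e2 := eqP h2.
case: (eqVneq x1 x2) => [x12 /= ny|nx _] /=; apply/eqP.
  have y12 : y1 = y2.
    have /eqP : (y1 - y2) * (y1 + y2) = 0.
      by rewrite -subr_sqr e1 e2 x12 subrr.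
    by rewrite mulf_eq0 subr_eq0 addr_eq0 (negPf ny) orbF => /eqP.
  have y2n0 : y1 *+ 2 != 0.
    by apply: contraNneq ny => y0; rewrite -y12 -addr_eq0 -mulr2n y0.
  rewrite -x12.
  set s := _ / _.
  have es : s * y1 *+ 2 = x1 ^+ 2 *+ 3 by rewrite -mulrnAr /s divfK.
  have -> : c = y1 ^+ 2 - x1 ^+ 3 by rewrite e1; ring.
  apply/eqP; rewrite -subr_eq0.
  have -> : (s * (x1 - (s ^+ 2 - x1 - x1)) - y1) ^+ 2
     - ((s ^+ 2 - x1 - x1) ^+ 3 + (y1 ^+ 2 - x1 ^+ 3))
     = (s * y1 *+ 2 - x1 ^+ 2 *+ 3) * (s ^+ 2 - x1 *+ 3) by ring.
  by rewrite es subrr mul0r.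
have dn0 : x2 - x1 != 0 by rewrite subr_eq0 eq_sym.
set s := _ / _.
have es : s * (x2 - x1) = y2 - y1 by rewrite /s divfK.
have ec : c = y1 ^+ 2 - x1 ^+ 3 by rewrite e1; ring.
have ey : y2 = y1 + s * (x2 - x1) by rewrite es; ring.
(* substituting the line into the cubic and dividing by [x2 - x1] *)
have k : (y1 *+ 2 * s + s ^+ 2 * (x2 - x1)) = x1 ^+ 2 + x1 * x2 + x2 ^+ 2.
  apply: (mulIf dn0).
  have -> : (y1 *+ 2 * s + s ^+ 2 * (x2 - x1)) * (x2 - x1)
     = (y1 + s * (x2 - x1)) ^+ 2 - y1 ^+ 2 by ring.
  by rewrite -ey e1 e2; ring.
apply/eqP; rewrite -subr_eq0 ec.
have -> : (s * (x1 - (s ^+ 2 - x1 - x2)) - y1) ^+ 2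
     - ((s ^+ 2 - x1 - x2) ^+ 3 + (y1 ^+ 2 - x1 ^+ 3))
   = (y1 *+ 2 * s + s ^+ 2 * (x2 - x1) - (x1 ^+ 2 + x1 * x2 + x2 ^+ 2))
     * (s ^+ 2 - x1 *+ 2 - x2) by ring.
by rewrite k subrr mul0r.
Qed.

Definition mordell_add (P Q : mordell) : mordell := Mordell (raw_add_on P Q).

Definition mordell_mul (n : nat) (P : mordell) : mordell :=
  iter n (mordell_add P) mordell_zero.

Definition is_torsion (P : mordell) : Prop :=
  exists2 n : nat, (0 < n)%N & mordell_mul n P = mordell_zero.

(* The group [G] is isomorphic to the torsion subgroup: a bijection of [G]
   onto the torsion points which carries [+] to the chord-and-tangent law. *)
Definition torsion_isom (G : zmodType) : Prop :=
  exists f : G -> mordell,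
    [/\ injective f,
        {morph f : g h / g + h >-> mordell_add g h}
      & forall P, is_torsion P <-> exists g, f g = P].

End MordellCurve.

(* Read in the rationals: neither the numerator nor the denominator (in lowest
   terms) is divisible by the sixth power of a prime. *)
Definition sixth_power_free (c : rat) : Prop :=
  forall q : nat, prime q ->
    ~~ (q ^ 6 %| `|numq c|)%N /\ ~~ (q ^ 6 %| `|denq c|)%N.

(* Meant for [0 < m]; unlike ['Z_m], it is the trivial group for [m = 1]. *)
Definition cyclic_group (m : nat) : zmodType := 'I_m.-1.+1.

Definition isomorphic (G H : zmodType) : Prop :=
  exists f : {additive G -> H}, bijective f.

(* A number field is a [fieldExtType rat]. *)
Definition PhiM (d : nat) (G : zmodType) : Prop :=
  exists (K : fieldExtType rat) (c : rat),
    [/\ \dim {:K} = d, c != 0 & torsion_isom (c%:A : K) G].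

(* Main.v *)
Require Import Defs.
From HB Require Import structures.
From mathcomp Require Import all_boot all_order all_algebra all_fingroup all_solvable all_field.
From mathcomp Require Import ring zify.
From Stdlib Require Import Classical.

(* The structure of the torsion is governed by three facts about a field [K] of
   odd degree [3 p].

   (1) No torsion of prime order [q >= 5]. For almost all primes [l = 2 mod 3],
   the odd degree of [K] provides a place of [K] above [l] with residue field of
   order [l ^ k], [k] odd, over which the curve has [l ^ k + 1] points because
   cubing is bijective; so a point of order [q] gives [l ^ k = -1 mod q]. In place
   of Dirichlet's theorem, such an [l] with [l ^ j = 1 mod q], [j] odd, is
   extracted from the norm of an element of [Z[zeta_q]]: if the norm is congruent
   to -1 mod 3, then it has a prime factor [l = 2 mod 3] of odd multiplicity [j],
   and for [l <> q] the [l]-part of a norm is congruent to 1 mod [q].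

   (2) The points of order 2, 3, 4 are controlled by square roots and cube roots of
   rationals in [K], hence there is at most one point of order 2, at most one
   subgroup of order 3 and no point of order 4.

   (3) Multiplication by 3 factors through the 3-isogeny to the curve with
   parameter [-27 c], so 9-division is the solution of two successive cubics. A
   point of order 9 forces [K] to contain a root [w] of [w ^ 3 = 3 w ^ 2 - 1] (the
   cyclic cubic field of conductor 9) and a cube root [v] of [4 c]. All prime
   factors of [K : Q(w)] = p exceed 3, so that [Q(w)] is closed under roots of
   cubics in [K]: this rules out order 18, which would make -4 a cube, and order
   27, which would solve [x ^ 3 = 3 w x ^ 2 + 1], impossible modulo 19.

   The values [c = 2, 8, 4, 1, 16], over the compositum of [Q(w)] with the field of
   a [p]-th root of 2, realise the five groups. *)

Set Implicit Arguments.
Unset Strict Implicit.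
Unset Printing Implicit Defensive.

Import Order.TTheory GRing.Theory Num.Theory.
Local Open Scope ring_scope.

(** * The group law *)

Section GroupLaw.

Variables (F : fieldType) (c : F).
Hypotheses (two_neq0 : (2%:R : F) != 0) (three_neq0 : (3%:R : F) != 0).
Hypothesis c_neq0 : c != 0.

Implicit Types P Q R : option (F * F).

Definition raw_opp P := if P is Some (x, y) then Some (x, - y) else None.

Lemma on_mordell_opp P : on_mordell c P -> on_mordell c (raw_opp P).
Proof. by case: P => [[x y]|] //=; rewrite sqrrN. Qed.

Lemma dbl_neq0 (y : F) : y != 0 -> y *+ 2 != 0.
Proof. by move=> y0; rewrite -mulr_natr mulf_neq0. Qed.

Lemma eq_oppr (y : F) : (y == - y) = (y == 0).
Proof. by rewrite -addr_eq0 -mulr2n -mulr_natr mulf_eq0 (negPf two_neq0) orbF. Qed.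

Lemma mordell_ord (x y1 y2 : F) :
  on_mordell c (Some (x, y1)) -> on_mordell c (Some (x, y2)) ->
  y1 = y2 \/ y1 = - y2.
Proof. by move=> /eqP e1 /eqP e2; apply/pred2P; rewrite -eqf_sqr e1 e2. Qed.

Lemma raw_addC P Q :
  on_mordell c P -> on_mordell c Q -> raw_add P Q = raw_add Q P.
Proof.
case: P Q => [[x1 y1]|] [[x2 y2]|] //= o1 o2; rewrite /slope.
have -> : (y1 == - y2) = (y2 == - y1) by rewrite -!addr_eq0 addrC.
rewrite [x2 == x1]eq_sym; case: eqVneq => [e|nx] /=; last first.
  have d : x2 - x1 != 0 by rewrite subr_eq0 eq_sym.
  have d' : x1 - x2 != 0 by rewrite subr_eq0.
  by congr (Some (_, _)); field; rewrite d d'.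
case: eqVneq => [//|n]; rewrite -e in o2 *.
case: (mordell_ord o1 o2) => ey; first by rewrite ey.
by rewrite ey opprK eqxx in n.
Qed.

(* The slope of a chord or of a tangent satisfies both relations, which lets the
   two cases be handled together. *)
Lemma slopeP (x1 y1 x2 y2 : F) :
  on_mordell c (Some (x1, y1)) -> on_mordell c (Some (x2, y2)) ->
  ~~ ((x1 == x2) && (y1 == - y2)) ->
  y2 - y1 = slope x1 y1 x2 y2 * (x2 - x1) /\
  slope x1 y1 x2 y2 * (y1 + y2) = x1 ^+ 2 + x1 * x2 + x2 ^+ 2.
Proof.
move=> o1 o2; rewrite /slope; case: eqVneq => [e|nx] /=.
  rewrite -e in o2 *; case: (mordell_ord o1 o2) => [->|->]; last by rewrite eqxx.
  rewrite eq_oppr => y0; have d := dbl_neq0 y0.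
  by split; [rewrite !subrr mulr0 | rewrite -mulr2n divfK //; ring].
have d : x2 - x1 != 0 by rewrite subr_eq0 eq_sym.
move=> _; split; first by rewrite divfK.
move/eqP: o1 => o1; move/eqP: o2 => o2.
field: o1 o2; exact: d.
Qed.

(** If [P + Q = Q], the line through [P] and [Q] also meets the curve at [- Q]; this forces
    [y2 = 0], then [3 * x2 ^ 2 = 0], a singular point, against [c != 0]. *)
Lemma raw_add_neq x2 y2 P :
  on_mordell c (Some (x2, y2)) -> on_mordell c P -> P != None ->
  raw_add P (Some (x2, y2)) != Some (x2, y2).
Proof.
case: P => [[x1 y1]|] // o2 o1 _ /=; case: ifPn => // h.
have [e1 e2] := slopeP o1 o2 h; move: (slope _ _ _ _) e1 e2 => s e1 e2.
apply/eqP => -[ex ey].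
have y0 : y2 = 0.
  apply/eqP; rewrite -eq_oppr -{1}ey ex; apply/eqP.
  by rewrite -[x1 - x2]opprB mulrN -e1 opprB addrAC subrr add0r.
have ey1 : y1 = - (s * (x2 - x1)) by rewrite -e1 y0; ring.
have k : x2 ^+ 2 *+ 3 = 0.
  have es : s ^+ 2 = x1 + x2 *+ 2 by rewrite mulr2n -{1}ex; ring.
  have e2' : s ^+ 2 * (x1 - x2) = x1 ^+ 2 + x1 * x2 + x2 ^+ 2.
    by rewrite -e2 y0 ey1; ring.
  have -> : x2 ^+ 2 *+ 3 = (x1 ^+ 2 + x1 * x2 + x2 ^+ 2)
                           - (x1 + x2 *+ 2) * (x1 - x2) by ring.
  by rewrite -es -e2' subrr.
have x0 : x2 = 0.
  by move/eqP: k; rewrite -mulr_natr mulf_eq0 (negPf three_neq0) orbF sqrf_eq0 => /eqP.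
move: o2; rewrite /= y0 x0 !expr0n /= add0r eq_sym => /eqP c0.
by move: c_neq0; rewrite c0 eqxx.
Qed.

(** Cancellation, obtained before associativity and used to settle its degenerate cases. *)
Lemma raw_addK P Q :
  on_mordell c P -> on_mordell c Q -> raw_add (raw_add P Q) (raw_opp Q) = P.
Proof.
case: Q => [[x2 y2]|] o1 o2; last by case: P o1 => [[? ?]|].
case: (eqVneq P None) => [-> /=|P0]; first by rewrite eqxx opprK eqxx.
have nQ := raw_add_neq o2 o1 P0.
case: P P0 o1 nQ => [[x1 y1]|] // _ o1 /=.
case: ifPn => [/andP[/eqP-> /eqP->] //|h nQ].
have [e1 e2] := slopeP o1 o2 h.
have oS := raw_add_on (Mordell o1) (Mordell o2).
rewrite /= (negPf h) in oS.
move: (slope x1 _ _ _) e1 e2 oS nQ => s e1 e2.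
set xa := s ^+ 2 - x1 - x2; set ya := s * (x1 - xa) - y1 => oS nQ.
rewrite /= opprK; case: ifPn => [/andP[/eqP ex /eqP ey]|h'].
  by rewrite ex ey eqxx in nQ.
(* Reflection in the horizontal axis carries the line through [P] and [Q] to the one through [P + Q]
   and [- Q], which may be a tangent. *)
have -> : slope xa ya x2 (- y2) = - s.
  rewrite /slope; case: eqVneq => [e|nx].
    have ya2 : ya = - y2.
      rewrite -/(on_mordell c (Some (xa, ya))) e in oS.
      by case: (mordell_ord oS o2) => // ey; rewrite e ey !eqxx in h'.
    have y20 : y2 != 0.
      by apply: contraNneq h' => y0; rewrite e ya2 y0 oppr0 !eqxx.
    apply: (mulIf (dbl_neq0 y20)); rewrite e ya2 mulNrn invrN.
    rewrite mulrN mulNr divfK ?dbl_neq0 // mulNr; congr (- _).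
    have es : s ^+ 2 = x1 + x2 *+ 2 by rewrite mulr2n -{1}e /xa; ring.
    have -> : x2 ^+ 2 *+ 3 = (x1 ^+ 2 + x1 * x2 + x2 ^+ 2)
                           - (x1 + x2 *+ 2) * (x1 - x2) by ring.
    rewrite -es -e2.
    have -> : y1 = y2 - s * (x2 - x1) by rewrite -e1; ring.
    ring.
  have d : x2 - xa != 0 by rewrite subr_eq0 eq_sym.
  apply: (mulIf d); rewrite divfK // /ya.
  have -> : y2 = y1 + s * (x2 - x1) by rewrite -e1; ring.
  by ring.
by congr (Some (_, _)); rewrite /ya /xa; ring.
Qed.

Lemma raw_oppK P : raw_opp (raw_opp P) = P.
Proof. by case: P => [[x y]|] //=; rewrite opprK. Qed.

Lemma raw_addKN P Q :
  on_mordell c P -> on_mordell c Q -> raw_add (raw_add P (raw_opp Q)) Q = P.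
Proof.
by move=> oP oQ; rewrite -{2}[Q]raw_oppK raw_addK // on_mordell_opp.
Qed.

(** The two affine branches of [raw_add], freed of their tests so that [field] can work on them. *)
Definition chord_sum (x1 y1 x2 y2 : F) :=
  let s := (y2 - y1) / (x2 - x1) in
  let x3 := s ^+ 2 - x1 - x2 in (x3, s * (x1 - x3) - y1).

Definition tangent_sum (x y : F) :=
  let s := (x ^+ 2 *+ 3) / (y *+ 2) in
  let x3 := s ^+ 2 - x - x in (x3, s * (x - x3) - y).

Lemma raw_add_chord (x1 y1 x2 y2 : F) : x2 - x1 != 0 ->
  raw_add (Some (x1, y1)) (Some (x2, y2)) = Some (chord_sum x1 y1 x2 y2).
Proof. by rewrite subr_eq0 eq_sym => /negPf n; rewrite /= /slope n. Qed.

Lemma raw_add_tangent (x y : F) : y != 0 ->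
  raw_add (Some (x, y)) (Some (x, y)) = Some (tangent_sum x y).
Proof. by move/negPf=> n; rewrite /= /slope eqxx eq_oppr n. Qed.

Lemma abscissa_neq (x1 y1 x2 y2 : F) :
  on_mordell c (Some (x1, y1)) -> on_mordell c (Some (x2, y2)) ->
  Some (x1, y1) != Some (x2, y2) -> Some (x1, y1) != Some (x2, - y2) ->
  x2 - x1 != 0.
Proof.
move=> o1 o2 n1 n2; rewrite subr_eq0 eq_sym; apply/eqP => e.
rewrite -e in o2 n1 n2.
by case: (mordell_ord o1 o2) => ey; rewrite ey eqxx in n1 n2.
Qed.

Lemma ordinate_neq0 (x y : F) : Some (x, y) != Some (x, - y) -> y != 0.
Proof. by apply: contraNneq => ->; rewrite oppr0. Qed.

(** [field] leaves denominators to be shown nonzero in expanded form; each is a known nonzero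
    quantity [a] times a nonzero [d] that clears its denominator. *)
Lemma neq0_factor (a b d : F) : a != 0 -> d != 0 -> a * d = b -> b != 0.
Proof. by move=> a0 d0 <-; rewrite mulf_neq0. Qed.

Lemma assoc_chords (x1 y1 x2 y2 x3 y3 xa ya xb yb : F) :
  on_mordell c (Some (x1, y1)) -> on_mordell c (Some (x2, y2)) ->
  on_mordell c (Some (x3, y3)) ->
  chord_sum x1 y1 x2 y2 = (xa, ya) -> chord_sum x2 y2 x3 y3 = (xb, yb) ->
  x2 - x1 != 0 -> x3 - x2 != 0 -> x3 - xa != 0 -> xb - x1 != 0 ->
  chord_sum xa ya x3 y3 = chord_sum x1 y1 xb yb.
Proof.
move=> /eqP o1 /eqP o2 /eqP o3 [<- <-] [<- <-] d1 d2 d3 d4.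
congr (_, _); field: o1 o2 o3; rewrite d1 d2 /=.
  by apply/andP; split; [apply: (neq0_factor d4 (expf_neq0 2 d2)); field; rewrite d2
                        |apply: (neq0_factor d3 (expf_neq0 2 d1)); field; rewrite d1].
by apply/andP; split; [apply: (neq0_factor d4 (expf_neq0 2 d2)); field; rewrite d2
                      |apply: (neq0_factor d3 (expf_neq0 2 d1)); field; rewrite d1].
Qed.

Lemma assoc_tangent_chord (x1 y1 x3 y3 xa ya xb yb : F) :
  on_mordell c (Some (x1, y1)) -> on_mordell c (Some (x3, y3)) ->
  tangent_sum x1 y1 = (xa, ya) -> chord_sum x1 y1 x3 y3 = (xb, yb) ->
  y1 != 0 -> x3 - x1 != 0 -> x3 - xa != 0 -> xb - x1 != 0 ->
  chord_sum xa ya x3 y3 = chord_sum x1 y1 xb yb.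
Proof.
move=> /eqP o1 /eqP o3 [<- <-] [<- <-] d1 d2 d3 d4.
congr (_, _); field: o1 o3; rewrite ?d1 ?d2 ?two_neq0 /=.
  by apply/andP; split; [apply: (neq0_factor d4 (expf_neq0 2 d2)); field; rewrite d2
    |apply: (neq0_factor d3 (expf_neq0 2 (dbl_neq0 d1))); field; rewrite two_neq0 d1].
by apply/andP; split; [apply: (neq0_factor d4 (expf_neq0 2 d2)); field; rewrite d2
    |apply: (neq0_factor d3 (expf_neq0 2 (dbl_neq0 d1))); field; rewrite two_neq0 d1].
Qed.

Lemma assoc_chord_tangent (x1 y1 x2 y2 xa ya xb yb : F) :
  on_mordell c (Some (x1, y1)) -> on_mordell c (Some (x2, y2)) ->
  chord_sum x1 y1 x2 y2 = (xa, ya) -> chord_sum x2 y2 xa ya = (xb, yb) ->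
  x2 - x1 != 0 -> xa - x2 != 0 -> ya != 0 -> xb - x1 != 0 ->
  tangent_sum xa ya = chord_sum x1 y1 xb yb.
Proof.
move=> /eqP o1 /eqP o2 [<- <-] [<- <-] d1 d2 d3 d4.
have k2 : (y2 - y1) ^+ 2 + - x1 * (x2 - x1) ^+ 2 + - x2 * (x2 - x1) ^+ 2 +
      - x2 * (x2 - x1) ^+ 2 != 0.
  by apply: (neq0_factor d2 (expf_neq0 2 d1)); field; rewrite d1.
congr (_, _); field: o1 o2; rewrite ?d1 k2 ?two_neq0 /=; apply/andP; split.
- by apply: (neq0_factor d4 (expf_neq0 2 (mulf_neq0 (expf_neq0 3 d1) d2))); field; rewrite d1 k2.
- by apply: (neq0_factor d3 (expf_neq0 3 d1)); field; rewrite d1.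
- by apply: (neq0_factor d4 (expf_neq0 2 (mulf_neq0 (expf_neq0 3 d1) d2))); field; rewrite d1 k2.
- by apply: (neq0_factor d3 (expf_neq0 3 d1)); field; rewrite d1.
Qed.

Lemma assoc_tangents (x y xa ya xb yb : F) :
  on_mordell c (Some (x, y)) ->
  tangent_sum x y = (xa, ya) -> chord_sum x y xa ya = (xb, yb) ->
  y != 0 -> xa - x != 0 -> ya != 0 -> xb - x != 0 ->
  tangent_sum xa ya = chord_sum x y xb yb.
Proof.
move=> /eqP o1 [<- <-] [<- <-] d1 d2 d3 d4.
have n1 := dbl_neq0 d1.
have k2 : (x ^+ 2 * 3) ^+ 2 + - x * (y ^+ 2 * 4) + - x * (y ^+ 2 * 4) +
      - x * (y ^+ 2 * 4) != 0.
  by apply: (neq0_factor d2 (expf_neq0 2 n1)); field; rewrite two_neq0 d1.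
congr (_, _); field: o1; rewrite ?d1 k2 ?two_neq0 /=; apply/andP; split.
- by apply: (neq0_factor d4 (expf_neq0 2 (mulf_neq0 (expf_neq0 3 n1) d2))); field; rewrite d1 two_neq0 k2.
- by apply: (neq0_factor d3 (expf_neq0 3 n1)); field; rewrite two_neq0 d1.
- by apply: (neq0_factor d4 (expf_neq0 2 (mulf_neq0 (expf_neq0 3 n1) d2))); field; rewrite d1 two_neq0 k2.
- by apply: (neq0_factor d3 (expf_neq0 3 n1)); field; rewrite two_neq0 d1.
Qed.

(** Here [T = (x2, 0)] has order 2 and the identity reads [2 (P + T) = 2 P]. It serves the case
    [P + Q = R], [R + Q = P] of associativity, which the four configurations above leave out. *)
Lemma tangent_add_two_torsion (x y x2 xa ya : F) :
  on_mordell c (Some (x, y)) -> on_mordell c (Some (x2, 0)) ->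
  chord_sum x y x2 0 = (xa, ya) ->
  y != 0 -> x2 - x != 0 -> ya != 0 -> tangent_sum xa ya = tangent_sum x y.
Proof.
move=> /eqP o1 /eqP o2 [<- <-] d1 d2 d3.
have ec : c = - x2 ^+ 3 by apply/eqP; rewrite -addr_eq0 addrC -o2 expr0n.
rewrite ec in o1.
congr (_, _); field: o1 o2; rewrite ?d1 ?d2 ?two_neq0 /=.
- by apply: (neq0_factor d3 (expf_neq0 3 d2)); field; rewrite d2.
- by apply: (neq0_factor d3 (expf_neq0 3 d2)); field; rewrite d2.
Qed.

Lemma raw_add_neqN P Q :
  on_mordell c P -> on_mordell c Q -> P != None -> raw_add P Q != Q.
Proof.
move=> oP; case: Q => [[x2 y2] oQ P0|_]; first exact: raw_add_neq.
by case: P oP => [[? ?]|].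
Qed.

Lemma raw_add0 P : raw_add P None = P.
Proof. by case: P => [[? ?]|]. Qed.

Lemma raw_add_id P : raw_add P (raw_opp P) = None.
Proof. by case: P => [[x y]|] //=; rewrite opprK !eqxx. Qed.

Lemma raw_addN P Q : raw_opp (raw_add P Q) = raw_add (raw_opp P) (raw_opp Q).
Proof.
case: P Q => [[x1 y1]|] [[x2 y2]|] //=; rewrite eqr_opp; case: ifP => //= h.
have -> : slope x1 (- y1) x2 (- y2) = - slope x1 y1 x2 y2.
  rewrite /slope; case: eqP => _; first by rewrite mulNrn invrN mulrN.
  by rewrite -opprD mulNr.
by congr (Some (_, _)); ring.
Qed.

Lemma raw_addNK P Q :
  on_mordell c P -> on_mordell c Q -> raw_add Q (raw_opp (raw_add P Q)) = raw_opp P.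
Proof.
move=> oP oQ; have oS := raw_add_on (Mordell oP) (Mordell oQ).
rewrite -[in RHS](raw_addK oP oQ) [in RHS]raw_addN raw_oppK.
by rewrite raw_addC ?on_mordell_opp.
Qed.

Local Arguments raw_add : simpl never.
Local Arguments chord_sum : simpl never.
Local Arguments tangent_sum : simpl never.

Lemma raw_add_closed P Q : on_mordell c P -> on_mordell c Q -> on_mordell c (raw_add P Q).
Proof. by move=> oP oQ; exact: (raw_add_on (Mordell oP) (Mordell oQ)). Qed.

Lemma chord_sumC (x1 y1 x2 y2 : F) : x2 - x1 != 0 ->
  chord_sum x2 y2 x1 y1 = chord_sum x1 y1 x2 y2.
Proof.
move=> d; have d' : x1 - x2 != 0 by rewrite -opprB oppr_eq0.
by rewrite /chord_sum; congr (_, _); field; rewrite d d'.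
Qed.

(** An operand, [P + Q] or [(P + Q) + R] is at infinity; cancellation settles these cases. *)
Lemma raw_addA_degenerate P Q R :
  on_mordell c P -> on_mordell c Q -> on_mordell c R ->
  [|| P == None, Q == None, R == None, P == raw_opp Q | raw_add P Q == raw_opp R] ->
  raw_add (raw_add P Q) R = raw_add P (raw_add Q R).
Proof.
move=> oP oQ oR; case/or4P=> [/eqP->|/eqP->|/eqP->|] //.
- by rewrite raw_add0.
- by rewrite !raw_add0.
case/orP=> /eqP e.
  rewrite e (raw_addC _ oQ) ?on_mordell_opp // raw_add_id /=.
  by rewrite (raw_addC oQ oR) [RHS]raw_addC ?raw_addK ?raw_add_closed ?on_mordell_opp.
have eR : R = raw_opp (raw_add P Q) by rewrite e raw_oppK.
rewrite eR raw_addNK // raw_add_id raw_add_id; exact.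
Qed.

Lemma raw_addA_dbl P R :
  on_mordell c P -> on_mordell c R ->
  raw_add (raw_add P P) R = raw_add P (raw_add P R).
Proof.
move=> oP oR.
case: (boolP [|| P == None, P == None, R == None, P == raw_opp P | raw_add P P == raw_opp R]).
  exact: raw_addA_degenerate.
rewrite !negb_or => /and5P[P0 _ R0 nPP nAR'].
case: (eqVneq P R) => [<-|nPR]; first by rewrite raw_addC ?raw_add_closed.
case: (eqVneq P (raw_opp R)) => [e|nPR'].
  have -> : raw_add P R = None.
    by rewrite e (raw_addC (on_mordell_opp oR)) // raw_add_id.
  have -> : R = raw_opp P by rewrite e raw_oppK.
  by rewrite raw_addK // raw_add0.
have nPB : P != raw_add P R by rewrite raw_addC // eq_sym raw_add_neqN.
have nPB' : P != raw_opp (raw_add P R).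
  apply: contraNneq nAR' => e; have := raw_addNK oR oP.
  by rewrite (raw_addC oR) // -e => ->.
case: P R P0 R0 oP oR nPP nAR' nPR nPR' nPB nPB' => [[x1 y1]|] // [[x3 y3]|] // _ _ oP oR.
move=> /ordinate_neq0 y10; have oA := raw_add_closed oP oP; have oB := raw_add_closed oP oR.
move=> nAR' nPR nPR'.
have d13 := abscissa_neq oP oR nPR nPR'.
rewrite raw_add_tangent // in oA nAR' *; rewrite raw_add_chord // in oB *.
case eA: (tangent_sum x1 y1) oA nAR' => [xa ya] oA nAR'.
case eB: (chord_sum x1 y1 x3 y3) oB => [xb yb] oB nPB nPB'.
have d1b := abscissa_neq oP oB nPB nPB'.
rewrite [in RHS]raw_add_chord //.
(* When [2 P = R], the sum on the left is itself a doubling. *)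
case: (eqVneq (Some (xa, ya)) (Some (x3, y3))) => [[ex ey]|nAR]; last first.
  have dA3 := abscissa_neq oA oR nAR nAR'.
  by rewrite raw_add_chord // (assoc_tangent_chord oP oR eA eB).
rewrite -ex -ey in oR nAR' d13 eB *.
have ya0 := ordinate_neq0 nAR'.
by rewrite raw_add_tangent // (assoc_tangents oP eA eB).
Qed.

Lemma raw_addA P Q R :
  on_mordell c P -> on_mordell c Q -> on_mordell c R ->
  raw_add (raw_add P Q) R = raw_add P (raw_add Q R).
Proof.
move=> oP oQ oR; have [oA oB] := (raw_add_closed oP oQ, raw_add_closed oQ oR).
case: (boolP [|| P == None, Q == None, R == None, P == raw_opp Q | raw_add P Q == raw_opp R]).
  exact: raw_addA_degenerate.
rewrite !negb_or => /and5P[P0 Q0 R0 nPQ' nAR'].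
case: (eqVneq P Q) => [e|nPQ]; first by rewrite e raw_addA_dbl // -e.
case: (eqVneq P R) => [<-|nPR]; first by rewrite (raw_addC oA) // (raw_addC oP oQ).
case: (eqVneq Q R) => [e|nQR].
  by rewrite -e (raw_addC oA) // (raw_addC oP) // -raw_addA_dbl // (raw_addC oP) // raw_add_closed.
case: (eqVneq Q (raw_opp R)) => [e|nQR'].
  by rewrite e raw_addKN // (raw_addC (on_mordell_opp oR)) // raw_add_id raw_add0.
have nPB' : P != raw_opp (raw_add Q R).
  apply: contraNneq nAR' => ->.
  by rewrite (raw_addC oQ oR) raw_addC ?on_mordell_opp // ?raw_addNK ?raw_add_closed //.
case: P Q R P0 Q0 R0 oP oQ oR oA oB nPQ nPQ' nPR nQR nQR' nPB' nAR'
  => [[x1 y1]|] // [[x2 y2]|] // [[x3 y3]|] // _ _ _ oP oQ oR oA oB nPQ nPQ' nPR nQR nQR' nPB' nAR'.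
have d12 := abscissa_neq oP oQ nPQ nPQ'.
have d23 := abscissa_neq oQ oR nQR nQR'.
have kP := raw_addK oP oQ.
rewrite (raw_add_chord _ _ d12) (raw_add_chord _ _ d23) in oA oB kP nPB' nAR' *.
have eBC := chord_sumC y2 y3 d23.
have eAC := chord_sumC y1 y2 d12.
case eA: (chord_sum x1 y1 x2 y2) eAC oA kP nAR' => [xa ya] eAC oA kP nAR'.
case eB: (chord_sum x2 y2 x3 y3) eBC oB nPB' => [xb yb] eBC oB nPB'.
case: (eqVneq (Some (xa, ya)) (Some (x3, y3))) => [[ex ey]|nAR].
  rewrite -ex -ey in oR d23 eB eBC nAR' *.
  have ya0 := ordinate_neq0 nAR'; rewrite raw_add_tangent //.
  case: (eqVneq (Some (x1, y1)) (Some (xb, yb))) => [[fx fy]|nPB]; last first.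
    have d1b := abscissa_neq oP oB nPB nPB'.
    by rewrite raw_add_chord // (assoc_chord_tangent oP oQ eA eB).
  (* here [P + Q = R] and [R + Q = P], so that [Q] has order 2 *)
  rewrite -fx -fy in nPB' eBC *.
  have y10 : y1 != 0 by exact: (ordinate_neq0 nPB').
  have Q2 : y2 = 0.
    have := raw_addK oQ oR; rewrite raw_add_chord // eB -fx -fy.
    have oQ' := on_mordell_opp oQ; rewrite -{1}kP (raw_addC oR oQ') raw_addK //.
    by case=> /esym/eqP; rewrite eq_oppr // => /eqP.
  rewrite Q2 in oQ eA.
  by rewrite raw_add_tangent // (tangent_add_two_torsion oP oQ eA).
have dA3 := abscissa_neq oA oR nAR nAR'.
rewrite raw_add_chord //.
case: (eqVneq (Some (x1, y1)) (Some (xb, yb))) => [[fx fy]|nPB]; last first.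
  have d1b := abscissa_neq oP oB nPB nPB'.
  by rewrite raw_add_chord // (assoc_chords oP oQ oR eA eB).
(* Here [P = Q + R], so the right side is a doubling: the mirror image of the chord-tangent case,
   with [P] and [R] exchanged. *)
rewrite -fx -fy in nPB' eBC *.
rewrite raw_add_tangent; last exact: ordinate_neq0 nPB'.
rewrite -(chord_sumC ya y3 dA3) (assoc_chord_tangent oR oQ eBC eAC) //.
- by rewrite -opprB oppr_eq0.
- by rewrite -opprB oppr_eq0.
- exact: ordinate_neq0 nPB'.
- by rewrite -opprB oppr_eq0.
Qed.

(** The discriminant of the curve is [- 432 * c ^ 2], and 432 has the prime factors 2 and 3. *)
Definition smooth := [&& (2%:R : F) != 0, (3%:R : F) != 0 & c != 0].

End GroupLaw.

(** * The points as an abelian group *)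

Section MordellGroup.

Variables (F : fieldType) (c : F) (sm : smooth c).

(* The smoothness proof is a phantom parameter, on which the group structure
   depends. *)
Definition mordell_group of smooth c : Type := mordell c.

HB.instance Definition _ := Choice.copy (mordell_group sm) (mordell c).

Definition mordell_opp (P : mordell_group sm) : mordell_group sm :=
  Mordell (on_mordell_opp (valP (P : mordell c))).

Let two_neq0 : (2%:R : F) != 0. Proof. by case/and3P: sm. Qed.
Let three_neq0 : (3%:R : F) != 0. Proof. by case/and3P: sm. Qed.
Let c_neq0 : c != 0. Proof. by case/and3P: sm. Qed.

Lemma mordell_addA : associative (@mordell_add F c : mordell_group sm -> _).
Proof.
move=> P Q R; apply: val_inj; symmetry.
by apply: (raw_addA two_neq0 three_neq0 c_neq0); apply: (valP (_ : mordell c)).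
Qed.

Lemma mordell_addC : commutative (@mordell_add F c : mordell_group sm -> _).
Proof. by move=> P Q; apply: val_inj; apply: raw_addC (valP _) (valP _). Qed.

Lemma mordell_add0 : left_id (mordell_zero c : mordell_group sm) (@mordell_add F c).
Proof. by move=> P; apply: val_inj. Qed.

Lemma mordell_addN :
  left_inverse (mordell_zero c : mordell_group sm) mordell_opp (@mordell_add F c).
Proof.
move=> P; rewrite mordell_addC; apply: val_inj; exact: raw_add_id.
Qed.

HB.instance Definition _ := GRing.isZmodule.Build (mordell_group sm)
  mordell_addA mordell_addC mordell_add0 mordell_addN.

Lemma mordell_mulE n (P : mordell_group sm) : mordell_mul n (P : mordell c) = P *+ n.
Proof. by elim: n => [|n IH] //; rewrite mulrS -IH. Qed.

Lemma val_add (P Q : mordell_group sm) :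
  val (P + Q : mordell c) = raw_add (val (P : mordell c)) (val (Q : mordell c)).
Proof. by []. Qed.

Lemma val_oppr (P : mordell_group sm) :
  val (- P : mordell c) = raw_opp (val (P : mordell c)).
Proof. by []. Qed.

Lemma val_eq0 (P : mordell_group sm) : (P == 0) = (val (P : mordell c) == None).
Proof. by []. Qed.

End MordellGroup.

(** * Torsion groups of order dividing 18 *)

Section TorsionStructure.

Variable V : zmodType.

Hypothesis no_large_prime :
  forall q, prime q -> (5 <= q)%N -> forall P : V, P *+ q = 0 -> P = 0.
Hypothesis two_torsion_uniq :
  forall P Q : V, P *+ 2 = 0 -> Q *+ 2 = 0 -> P != 0 -> Q != 0 -> P = Q.
Hypothesis no_order4 : forall P : V, P *+ 4 = 0 -> P *+ 2 = 0.
Hypothesis three_torsion_uniq :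
  forall P Q : V, P *+ 3 = 0 -> Q *+ 3 = 0 -> P != 0 -> Q != 0 -> Q = P \/ Q = - P.
Hypothesis no_order27 : forall P : V, P *+ 27 = 0 -> P *+ 9 = 0.
Hypothesis no_order18 :
  forall P Q : V, P *+ 9 = 0 -> Q *+ 2 = 0 -> Q != 0 -> P *+ 3 = 0.

(** Descent on the exponent: a factor 4, 27 or a prime [q >= 5] of [n] is lowered to 2, 9 or 1, and
    an exponent without such factors divides 18. *)
Lemma torsion_dvd18 n (P : V) : (0 < n)%N -> P *+ n = 0 -> P *+ 18 = 0.
Proof.
elim/ltn_ind: n => n IH n0 Pn.
have red d e : (0 < e < d)%N -> (d %| n)%N ->
    (forall Q : V, Q *+ d = 0 -> Q *+ e = 0) -> P *+ 18 = 0.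
  case/andP=> e0 ed /dvdnP[k ek] h; rewrite ek muln_gt0 in n0.
  case/andP: n0 => k0 d0; apply: (IH (k * e)%N); last 1 first.
  - by rewrite mulrnA h // -mulrnA -ek.
  - by rewrite ek ltn_pmul2l.
  - by rewrite muln_gt0 k0.
case: (boolP (4 %| n)%N) => [h|n4]; first by apply: (red _ 2%N _ h no_order4).
case: (boolP (27 %| n)%N) => [h|n27]; first by apply: (red _ 9%N _ h no_order27).
case: (boolP (has (fun q => 4 < q)%N (primes n))) => [/hasP[q]|/hasPn hs].
  rewrite mem_primes => /and3P[pq _ qn] q5; apply: (red q 1%N _ qn).
    by rewrite prime_gt1.
  by move=> Q; rewrite mulr1n; apply: no_large_prime.
suff /dvdnP[k ->] : (n %| 18)%N by rewrite mulnC mulrnA Pn mul0rn.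
apply/dvdn_partP => // q; rewrite mem_primes => /and3P[pq _ qn].
have : (q <= 4)%N by rewrite leqNgt hs // mem_primes pq n0.
have e2 : (logn 2 n <= 1)%N by rewrite leqNgt -(pfactor_dvdn 2).
have e3 : (logn 3 n <= 2)%N by rewrite leqNgt -(pfactor_dvdn 3).
move: pq e2 e3 {qn}; case: q => [|[|[|[|[|]]]]] // _ e2 e3 _; rewrite p_part.
  by apply: dvdn_trans (dvdn_exp2l _ e2) _.
by apply: dvdn_trans (dvdn_exp2l _ e3) _.
Qed.

Definition order_is (g : V) m :=
  g *+ m = 0 /\ forall k, (0 < k < m)%N -> g *+ k != 0.

Lemma order_is_dvd (g : V) m k :
  order_is g m -> (0 < m)%N -> g *+ k = 0 -> (m %| k)%N.
Proof.
move=> [gm ord] m0; rewrite {1}(divn_eq k m) mulrnDr mulnC mulrnA gm mul0rn add0r.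
rewrite /dvdn => gk; apply/negPn; rewrite -lt0n; apply/negP => k0.
by have := ord (k %% m)%N; rewrite gk eqxx k0 ltn_pmod // => /(_ isT).
Qed.

(** A torsion point splits into a part killed by 2 and a part killed by 9. The generator is
    assembled from a point of order 2, 3 or 9 when there is one; [no_order18] keeps 2 and 9
    apart. *)
Lemma torsion_generator :
  exists2 m, m \in [:: 1; 2; 3; 6; 9]%N &
  exists2 g : V, order_is g m &
    forall P : V, (exists2 n, (0 < n)%N & P *+ n = 0) -> exists k, P = g *+ k.
Proof.
have split18 (P : V) : P *+ 18 = 0 -> exists A B,
    [/\ P = A + B, A *+ 2 = 0 & B *+ 9 = 0].
  (* 9 and 10 are the complementary idempotents modulo 18. *)
  move=> h; exists (P *+ 9), (P *+ 10); rewrite -mulrnDr -!mulrnA.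
  split=> //; first by rewrite -[(9 + 10)%N]/(1 + 18)%N mulrnDr h addr0.
  by rewrite -[(10 * 9)%N]/(18 * 5)%N mulrnA h mul0rn.
have two (T : V) : T *+ 2 = 0 -> T != 0 -> forall A : V, A *+ 2 = 0 -> exists k, A = T *+ k.
  move=> T2 T0 A A2; case: (eqVneq A 0) => [->|A0]; first by exists 0%N.
  by exists 1%N; apply: two_torsion_uniq.
have three (T : V) : T *+ 3 = 0 -> T != 0 -> forall A : V, A *+ 3 = 0 -> exists k, A = T *+ k.
  move=> T3 T0 A A3; case: (eqVneq A 0) => [->|A0]; first by exists 0%N.
  case: (three_torsion_uniq T3 A3 T0 A0) => ->; first by exists 1%N.
  exists 2%N; apply/eqP; rewrite eq_sym -addr_eq0; apply/eqP.
  by rewrite -[RHS]T3 [in RHS]mulrSr.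
have ord2 (T : V) : T *+ 2 = 0 -> T != 0 -> order_is T 2.
  by move=> T2 T0; split=> // -[|[|]].
have ord3 (T : V) : T *+ 3 = 0 -> T != 0 -> order_is T 3.
  move=> T3 T0; split=> // -[|[|[|]]] // _; apply: contraNneq T0 => T2.
  by rewrite -T3 mulrSr T2 add0r.
have [[T2 [T2e T20]]|nT2] := classic (exists T : V, T *+ 2 = 0 /\ T != 0).
  have three9 (B : V) : B *+ 9 = 0 -> B *+ 3 = 0 by move/no_order18; apply; eauto.
  have [[T3 [T3e T30]]|nT3] := classic (exists T : V, T *+ 3 = 0 /\ T != 0).
    exists 6%N => //; exists (T2 + T3).
      split=> [|k].
        by rewrite mulrnDl -[6%N]/(2 * 3)%N mulrnA T2e mul0rn mulnC mulrnA T3e mul0rn addr0.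
      move=> /andP[k0 k6]; apply/negP => /eqP e.
      have e3 : T2 *+ k = 0.
        have : (T2 + T3) *+ k *+ 3 = 0 by rewrite e mul0rn.
        rewrite mulrnDl mulrnDl -[T3 *+ _ *+ _]mulrnAC T3e mul0rn addr0.
        by rewrite mulrSr -mulrnA mulnC mulrnA T2e mul0rn add0r.
      have e2 : T3 *+ k = 0 by move: e; rewrite mulrnDl e3 add0r.
      have k2 := order_is_dvd (ord2 _ T2e T20) (isT : 0 < 2)%N e3.
      have k3 := order_is_dvd (ord3 _ T3e T30) (isT : 0 < 3)%N e2.
      have := @Gauss_dvd 2 3 k isT; rewrite k2 k3 /= => /dvdn_leq; lia.
    move=> P [n n0 /(torsion_dvd18 n0)]; move=> /split18[A [B [-> A2 B9]]].
    have [i ->] := two _ T2e T20 _ A2; have [j ->] := three _ T3e T30 _ (three9 _ B9).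
    (* Chinese remainders: 3 is 1 modulo 2 and 0 modulo 3, while 4 is 0 modulo 2 and 1 modulo 3. *)
    exists (i * 3 + j * 4)%N; rewrite mulrnDl !mulrnDr.
    rewrite [(i * 3)%N]mulnC [(j * 4)%N]mulnC !mulrnA T3e !mul0rn add0r.
    rewrite [T2 *+ 3]mulrSr T2e add0r -[4%N]/(2 * 2)%N mulrnA T2e !mul0rn addr0.
    by rewrite [T3 *+ 4]mulrSr T3e add0r.
  exists 2%N => //; exists T2; first exact: ord2.
  move=> P [n n0 /(torsion_dvd18 n0)]; move=> /split18[A [B [-> A2 B9]]].
  have -> : B = 0; last by rewrite addr0; apply: two A2.
  by apply/eqP; apply/negPn/negP => B0; apply: nT3; exists B; split; rewrite ?three9.
have A0 (A : V) : A *+ 2 = 0 -> A = 0.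
  by move=> A2; apply/eqP/negPn/negP => A0; apply: nT2; exists A.
have [[T9 [T9e T93]]|nT9] := classic (exists T : V, T *+ 9 = 0 /\ T *+ 3 != 0).
  exists 9%N => //; exists T9.
    split=> // k /andP[k0 k9]; apply: contraNneq T93 => e.
    case: (boolP (3 %| k)%N) => [/dvdnP[j ej]|k3].
      move: e k0 k9; rewrite ej; case: j {ej} => [|[|[|j]]] // e _ _; apply/eqP => //.
      have : T9 *+ 3 *+ 3 = 0 by rewrite -mulrnA.
      by rewrite mulrSr -mulrnA (e : T9 *+ (3 * 2) = 0) add0r.
    have : coprime k 9 by rewrite (@coprimeXr 2 k 3) // coprime_sym prime_coprime.
    case/(coprimeP _ k0) => -[u v] /= /eqP huv.
    have -> : T9 = 0; last by rewrite mul0rn.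
    rewrite -[T9]mulr1n -(eqP huv) mulrnBr; last by rewrite leqNgt -subn_eq0; lia.
    by rewrite [(u * k)%N]mulnC [(v * 9)%N]mulnC !mulrnA e T9e !mul0rn subr0.
  move=> P [n n0 /(torsion_dvd18 n0)]; move=> /split18[A [B [-> /A0-> B9]]].
  rewrite add0r; have t93 : T9 *+ 3 *+ 3 = 0 by rewrite -mulrnA.
  (* [3 B] is a multiple of [3 T9], so [B] differs from a multiple of [T9] by a point killed by 3,
     again a multiple of [T9]. *)
  have [k ek] : exists k, B *+ 3 = T9 *+ 3 *+ k by apply: three; rewrite // -mulrnA.
  have [j ej] : exists j, B - T9 *+ k = T9 *+ 3 *+ j.
    by apply: three; rewrite // mulrnBl ek mulrnAC subrr.
  by exists (k + 3 * j)%N; rewrite mulrnDr mulrnA -ej addrC subrK.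
have B3 (B : V) : B *+ 9 = 0 -> B *+ 3 = 0.
  by move=> B9; apply/eqP/negPn/negP => B3; apply: nT9; exists B.
have [[T3 [T3e T30]]|nT3] := classic (exists T : V, T *+ 3 = 0 /\ T != 0).
  exists 3%N => //; exists T3; first exact: ord3.
  move=> P [n n0 /(torsion_dvd18 n0)]; move=> /split18[A [B [-> /A0-> /B3 B9]]].
  by rewrite add0r; apply: three.
exists 1%N => //; exists 0; first by split; [rewrite mul0rn | case=> [|[]]].
move=> P [n n0 /(torsion_dvd18 n0)]; move=> /split18[A [B [-> /A0-> /B3 B9]]].
exists 0%N; rewrite add0r; apply/eqP/negPn/negP => B0; apply: nT3; by exists B.
Qed.

End TorsionStructure.

(** * Points of small order *)

Section SmallTorsion.

Variables (F : fieldType) (c : F) (sm : smooth c).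
Implicit Types P Q R : mordell_group sm.

Let two_neq0 : (2%:R : F) != 0. Proof. by case/and3P: sm. Qed.
Let three_neq0 : (3%:R : F) != 0. Proof. by case/and3P: sm. Qed.
Let c_neq0 : c != 0. Proof. by case/and3P: sm. Qed.

Lemma coords P : P != 0 ->
  exists x y, val (P : mordell c) = Some (x, y) /\ y ^+ 2 = x ^+ 3 + c.
Proof.
rewrite val_eq0; case: P => [[[x y]|] // h] _; exists x, y; split=> //.
exact/eqP.
Qed.

Lemma order2_coords P x y : val (P : mordell c) = Some (x, y) ->
  (P *+ 2 == 0) = (y == 0).
Proof.
by move=> e; rewrite mulr2n val_eq0 val_add e /= eqxx eq_oppr //; case: ifP.
Qed.

Lemma order2_point P : P *+ 2 = 0 -> P != 0 ->
  exists2 x, val (P : mordell c) = Some (x, 0) & x ^+ 3 = - c.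
Proof.
move=> P2 /coords[x [y [e h]]]; have := order2_coords e.
rewrite P2 eqxx => /esym/eqP y0; exists x; first by rewrite e y0.
by apply/eqP; rewrite -addr_eq0 -h y0 expr0n.
Qed.

Lemma double_coords P x y : val (P : mordell c) = Some (x, y) -> y != 0 ->
  val (P *+ 2 : mordell c) = Some (tangent_sum x y).
Proof. by move=> e y0; rewrite mulr2n val_add e raw_add_tangent. Qed.

(** Comparing the abscissae of [2 P] and [- P] yields the third division polynomial
    [3 * x * (x ^ 3 + 4 * c)]. *)
Lemma order3_point P : P *+ 3 = 0 -> P != 0 ->
  exists x y, [/\ val (P : mordell c) = Some (x, y), y ^+ 2 = x ^+ 3 + c
                & x = 0 \/ x ^+ 3 = - (c *+ 4)].
Proof.
move=> P3 P0; have [x [y [e h]]] := coords P0; exists x, y; split=> //.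
have P2 : P *+ 2 = - P by apply/eqP; rewrite -addr_eq0 -mulrSr P3.
have y0 : y != 0 by rewrite -(order2_coords e) P2 oppr_eq0.
have := double_coords e y0; rewrite P2 val_oppr e => -[ex _].
have k : x * (x ^+ 3 + c *+ 4) * 3%:R = 0.
  have : x * (y *+ 2) ^+ 2 = ((x ^+ 2 *+ 3 / (y *+ 2)) ^+ 2 - x - x) * (y *+ 2) ^+ 2.
    by rewrite -ex.
  have -> : ((x ^+ 2 *+ 3 / (y *+ 2)) ^+ 2 - x - x) * (y *+ 2) ^+ 2
    = x ^+ 4 *+ 9 - x * y ^+ 2 *+ 8 by field; rewrite y0 two_neq0.
  rewrite -mulrnAl exprMn_n h => /eqP; rewrite -subr_eq0 => /eqP k.
  by rewrite -[RHS]k; ring.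
move/eqP: k; rewrite !mulf_eq0 (negPf three_neq0) orbF => /orP[/eqP->|]; first by left.
by rewrite addr_eq0 => /eqP; right.
Qed.

(** With [2 P = (t, 0)], the duplication formula becomes the square of
    [x ^ 2 - 2 * t * x - 2 * t ^ 2], whose roots are [t * (1 + u)] with [u ^ 2 = 3]. *)
Lemma order4_sqrt3 P : P *+ 4 = 0 -> P *+ 2 != 0 -> exists u : F, u ^+ 2 = 3%:R.
Proof.
move=> P4 P2; have P0 : P != 0 by apply: contraNneq P2 => ->; rewrite mul0rn.
have [x [y [e h]]] := coords P0.
have y0 : y != 0 by rewrite -(order2_coords e).
have [t] : exists2 t, val (P *+ 2 : mordell c) = Some (t, 0) & t ^+ 3 = - c.
  by apply: order2_point; rewrite -?mulrnA.
rewrite (double_coords e y0) => -[et _ tc].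
have t0 : t != 0.
  by apply: contraNneq c_neq0 => t0; rewrite -oppr_eq0 -tc t0 expr0n.
have hc : c = - t ^+ 3 by rewrite tc opprK.
have k : (x ^+ 2 - t * x *+ 2 - t ^+ 2 *+ 2) ^+ 2 = 0.
  have : t * (y *+ 2) ^+ 2 = ((x ^+ 2 *+ 3 / (y *+ 2)) ^+ 2 - x - x) * (y *+ 2) ^+ 2.
    by rewrite et.
  have -> : ((x ^+ 2 *+ 3 / (y *+ 2)) ^+ 2 - x - x) * (y *+ 2) ^+ 2
    = x ^+ 4 *+ 9 - x * y ^+ 2 *+ 8 by field; rewrite y0 two_neq0.
  rewrite exprMn_n h hc => /eqP; rewrite -subr_eq0 => /eqP k.
  by rewrite -[RHS]oppr0 -k; ring.
move/eqP: k; rewrite sqrf_eq0 => /eqP k; exists (x / t - 1).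
have -> : (x / t - 1) ^+ 2 = (x ^+ 2 - t * x *+ 2 - t ^+ 2 *+ 2) / t ^+ 2 + 3%:R.
  by field.
by rewrite k mul0r add0r.
Qed.

(* [X] is the abscissa of the image of [P] under the 3-isogeny to the curve with
   parameter [-27 c]; multiplication by 3 factors through it, which splits the
   equation of degree 9 for the abscissa of [P] into two cubics. *)
Lemma triple_coords P x y a b :
  val (P : mordell c) = Some (x, y) -> P *+ 2 != 0 ->
  val (P *+ 3 : mordell c) = Some (a, b) ->
  exists X : F, [/\ x != 0, X != 0, X ^+ 3 = a * X ^+ 2 *+ 9 + c *+ 108
              & x ^+ 3 = X * x ^+ 2 - c *+ 4].
Proof.
move=> e P2 e3; have y0 : y != 0 by rewrite -(order2_coords e).
have h : y ^+ 2 = x ^+ 3 + c by have := valP (P : mordell c); rewrite e => /eqP.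
have P0 : P != 0 by apply: contraNneq P2 => ->; rewrite mul0rn.
have P3 : P *+ 3 != 0 by rewrite val_eq0 e3.
have e2 := double_coords e y0; case ed: (tangent_sum x y) e2 => [x2 y2] e2.
have nx : x2 - x != 0.
  apply: (@abscissa_neq _ c _ y _ y2).
  - by have := valP (P : mordell c); rewrite e.
  - by have := valP (P *+ 2 : mordell c); rewrite e2.
  - rewrite -e -e2; apply: contraNneq P0 => /val_inj k.
    by rewrite -(subrr P) {2}k mulr2n addrK.
  - apply: contraNneq P3 => k; have {}k : P = - (P *+ 2).
      by apply: val_inj; rewrite [LHS]e [RHS]val_oppr e2.
    by rewrite mulrSr {2}k subrr.
move: e3; rewrite mulrS val_add e e2 raw_add_chord // => -[ea _].
case: ed => ex2 ey2.
(* [x2 - x] is [- 3 * x * (x ^ 3 + 4 * c)] divided by [(2 * y) ^ 2]. *)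
have n : x * (x ^+ 3 + c *+ 4) != 0.
  have := mulf_neq0 nx (expf_neq0 2 (dbl_neq0 two_neq0 y0)).
  rewrite -ex2; have -> : (((x ^+ 2 *+ 3 / (y *+ 2)) ^+ 2 - x - x) - x) * (y *+ 2) ^+ 2
    = x ^+ 4 *+ 9 - x * y ^+ 2 *+ 12 by field; rewrite y0 two_neq0.
  apply: contraNneq => k; rewrite h; have := k => /(congr1 (fun z => - (z *+ 3))).
  by rewrite mul0rn oppr0 => {}k; rewrite -[X in _ == X]k; apply/eqP; ring.
move: (n); rewrite mulf_eq0 negb_or => /andP[x0 n4].
(* The triplication formula for the abscissa, cleared of denominators. *)
have key : a * x ^+ 2 * (x ^+ 3 + c *+ 4) ^+ 2 *+ 9
   = x ^+ 9 - c * x ^+ 6 *+ 96 + c ^+ 2 * x ^+ 3 *+ 48 + c ^+ 3 *+ 64.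
  rewrite -ea -ey2 -ex2; rewrite -ex2 in nx.
  have n1 := dbl_neq0 two_neq0 y0.
  field: h; rewrite y0 two_neq0 /=.
  by apply: (neq0_factor nx (expf_neq0 2 n1)); field; rewrite y0 two_neq0.
exists ((x ^+ 3 + c *+ 4) / x ^+ 2); split=> //.
- by apply: mulf_neq0 => //; rewrite invr_eq0 expf_neq0.
- apply: (mulIf (expf_neq0 6 x0)).
  have -> : (a * ((x ^+ 3 + c *+ 4) / x ^+ 2) ^+ 2 *+ 9 + c *+ 108) * x ^+ 6
    = a * x ^+ 2 * (x ^+ 3 + c *+ 4) ^+ 2 *+ 9 + c * x ^+ 6 *+ 108 by field.
  by rewrite key; field.
- by rewrite divfK ?expf_neq0 // addrK.
Qed.

End SmallTorsion.

(** * Cubic equations in a number field of degree 3 p *)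

Lemma odd_mul3_prime p : prime p -> (5 <= p)%N -> odd (3 * p).
Proof. by move=> pp p5; rewrite oddM /=; case: (even_prime pp) => // e; rewrite e in p5. Qed.

Section CubicCoordinates.

Variable R : comNzRingType.
Implicit Types a b c n w : R.

(* The coordinates on [1, w, w^2] of [u^3 - 3 n w u^2 - n^3], where
   [u = a + b w + c w^2] and [w^3 = 3 w^2 - 1]. *)
Definition sq0 a b c := a ^+ 2 - b * c *+ 2 - c ^+ 2 *+ 3.
Definition sq1 a b c := a * b *+ 2 - c ^+ 2.
Definition sq2 a b c := b ^+ 2 + a * c *+ 2 + b * c *+ 6 + c ^+ 2 *+ 9.
Definition form0 a b c n :=
  a * sq0 a b c - b * sq2 a b c - c * sq1 a b c - c * sq2 a b c *+ 3
  + n * sq2 a b c *+ 3 - n ^+ 3.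
Definition form1 a b c n :=
  a * sq1 a b c + b * sq0 a b c - c * sq2 a b c - n * sq0 a b c *+ 3.
Definition form2 a b c n :=
  a * sq2 a b c + b * sq1 a b c + c * sq0 a b c + b * sq2 a b c *+ 3
  + c * sq1 a b c *+ 3 + c * sq2 a b c *+ 9
  - n * (sq1 a b c + sq2 a b c *+ 3) *+ 3.

Lemma formE a b c n w : w ^+ 3 = w ^+ 2 *+ 3 - 1 ->
  let u := a + b * w + c * w ^+ 2 in
  form0 a b c n + form1 a b c n * w + form2 a b c n * w ^+ 2
  = u ^+ 3 - n * w * u ^+ 2 *+ 3 - n ^+ 3.
Proof.
move=> ew u; rewrite /u /form0 /form1 /form2 /sq0 /sq1 /sq2; ring: ew.
Qed.

End CubicCoordinates.

Lemma form_rmorph (R S : comNzRingType) (f : {rmorphism R -> S}) a b c n :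
  [/\ form0 (f a) (f b) (f c) (f n) = f (form0 a b c n),
      form1 (f a) (f b) (f c) (f n) = f (form1 a b c n)
    & form2 (f a) (f b) (f c) (f n) = f (form2 a b c n)].
Proof.
by split; rewrite /form0 /form1 /form2 /sq0 /sq1 /sq2;
  rewrite !(rmorphD, rmorphN, rmorphMn, rmorphM, rmorphXn).
Qed.

(* Modulo 19 the cubic of [w] splits, while [u^3 - 3 w u^2 - 1] has no root for
   any of the three values of [w]. *)
Lemma form_descent19 (a b c n : int) :
  form0 a b c n = 0 -> form1 a b c n = 0 -> form2 a b c n = 0 ->
  [/\ (19 %| a)%Z, (19 %| b)%Z, (19 %| c)%Z & (19 %| n)%Z].
Proof.
move=> f0 f1 f2; rewrite !(dvdz_pcharf (pchar_Fp (isT : prime 19))).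
have [] := form_rmorph (intr : {rmorphism int -> 'F_19}) a b c n.
rewrite f0 f1 f2 rmorph0 /=.
move: (a%:~R : 'F_19) (b%:~R) (c%:~R) (n%:~R) => {f0 f1 f2 a b c n} a b c n e0 e1 e2.
have key (w : 'F_19) : w \in [:: 11%:R; 13%:R; 17%:R] ->
    n = 0 /\ a + b * w + c * w ^+ 2 = 0.
  move=> hw; have [ew nr] : w ^+ 3 = w ^+ 2 *+ 3 - 1 /\
      forall m : 'F_19, m ^+ 3 - w * m ^+ 2 *+ 3 - 1 != 0.
    (* The absence of roots is tested on natural numbers, [k] standing for [- 3 * w] and 18 for -1
       modulo 19. *)
    have cl (k : nat) : all (fun m => ~~ (19 %| m ^ 3 + k * m ^ 2 + 18)%N) (iota 0 19) ->
        - (w *+ 3) = k%:R -> forall m : 'F_19, m ^+ 3 - w * m ^+ 2 *+ 3 - 1 != 0.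
      move=> /allP ok ek m; have -> : m ^+ 3 - w * m ^+ 2 *+ 3 - 1
          = (m ^ 3 + k * m ^ 2 + 18)%:R.
        rewrite !natrD natrM !natrX natr_Zp -ek.
        have -> : 18%:R = -1 :> 'F_19 by apply/eqP; vm_compute.
        by ring.
      rewrite -(dvdn_pcharf (pchar_Fp (isT : prime 19))) ok // mem_iota add0n.
      exact: ltn_ord.
    move: hw cl; rewrite !inE => /or3P[]/eqP-> cl; split; try (by apply/eqP; vm_compute).
    - by apply: (cl 24%N); last by apply/eqP; vm_compute.
    - by apply: (cl 18%N); last by apply/eqP; vm_compute.
    - by apply: (cl 6%N); last by apply/eqP; vm_compute.
  have := formE a b c n ew; rewrite e0 e1 e2 !mul0r !addr0 => /esym.
  set u := a + _ + _ => eu.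
  have n0 : n = 0.
    apply/eqP/negPn/negP => n0; have := nr (u / n); rewrite -(mulIr_eq0 _ (mulIf (expf_neq0 3 n0))).
    have -> : ((u / n) ^+ 3 - w * (u / n) ^+ 2 *+ 3 - 1) * n ^+ 3
      = u ^+ 3 - n * w * u ^+ 2 *+ 3 - n ^+ 3 by field.
    by rewrite eu eqxx.
  split=> //; move: eu; rewrite n0 !mul0r mul0rn !expr0n /= !subr0 => /eqP.
  by rewrite expf_eq0 /= => /eqP.
have [|n0 k1] := key 11%:R; first by [].
have [|_ k2] := key 13%:R; first by [].
have [|_ k3] := key 17%:R; first by [].
have h2 : (2%:R : 'F_19) != 0 by [].
(* [a + b * w + c * w ^ 2] vanishes at 11, 13 and 17; divided differences, with 24 = 11 + 13 and 30
   = 13 + 17, make its coefficients zero. *)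
have h12 : b + c * 24%:R = 0.
  apply: (mulIf h2); rewrite mul0r -(subrr (0 : 'F_19)) -{1}k2 -k1; ring.
have h4 : (4%:R : 'F_19) != 0 by [].
have h23 : b + c * 30%:R = 0.
  apply: (mulIf h4); rewrite mul0r -(subrr (0 : 'F_19)) -{1}k3 -k2; ring.
have h6 : (6%:R : 'F_19) != 0 by [].
have c0 : c = 0.
  apply: (mulIf h6); rewrite mul0r -(subrr (0 : 'F_19)) -{1}h23 -h12; ring.
have b0 : b = 0 by move: h12; rewrite c0 mul0r addr0.
have a0 : a = 0 by move: k1; rewrite b0 c0 !mul0r !addr0.
by rewrite a0 b0 c0 n0 eqxx.
Qed.

Lemma form_scale (R : comNzRingType) (k a b c n : R) :
  [/\ form0 (k * a) (k * b) (k * c) (k * n) = k ^+ 3 * form0 a b c n,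
      form1 (k * a) (k * b) (k * c) (k * n) = k ^+ 3 * form1 a b c n
    & form2 (k * a) (k * b) (k * c) (k * n) = k ^+ 3 * form2 a b c n].
Proof.
by split; rewrite /form0 /form1 /form2 /sq0 /sq1 /sq2; ring.
Qed.

(** Infinite descent: an integral zero is divisible by 19, and the forms are homogeneous of degree
    3. *)
Lemma form_int_eq0 (a b c n : int) :
  form0 a b c n = 0 -> form1 a b c n = 0 -> form2 a b c n = 0 -> n = 0.
Proof.
have [m] := ubnP `|n|%N; elim: m a b c n => // m IH a b c n nm f0 f1 f2.
apply/eqP/negPn/negP => n0.
case: (form_descent19 f0 f1 f2) => /dvdzP[a' ea] /dvdzP[b' eb] /dvdzP[c' ec] /dvdzP[n' en].
have [] := form_scale 19 a' b' c' n'.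
rewrite ![19 * _]mulrC -ea -eb -ec -en f0 f1 f2 => /esym g0 /esym g1 /esym g2.
have k (z : int) : 19 ^+ 3 * z = 0 -> z = 0 by move/eqP; rewrite mulf_eq0 => /orP[//|/eqP].
have n'0 : n' = 0.
  apply: (IH a' b' c'); try exact: k.
  move: nm n0; rewrite en abszM /= => h; rewrite mulf_eq0 negb_or -absz_gt0 => /andP[h' _].
  by move: h h'; rewrite ltnS; lia.
by rewrite en n'0 mul0r eqxx in n0.
Qed.

(** * Roots of polynomials in a number field *)

Section NumberField.

Variable K : fieldExtType rat.
Implicit Types (U : {subfield K}) (x : K).

(** The degree of [x] over [U] divides [n = [K : U]] and is less than [size q], so it can only be
    1. *)
Lemma root_in_subfield U x (q : {poly K}) n :
  q \is a polyOver U -> q != 0 -> root q x -> (\dim {:K} = n * \dim U)%N ->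
  (forall d, (1 < d < size q)%N -> ~~ (d %| n)%N) -> x \in U.
Proof.
move=> qU q0 qx en hd; rewrite -adjoin_deg_eq1.
have sz : (adjoin_degree U x < size q)%N.
  by rewrite -size_minPoly dvdp_leq // minPoly_dvdp.
have dn : (adjoin_degree U x %| n)%N.
  have := field_dimS (subvf <<U; x>>%AS); rewrite dim_Fadjoin en dvdn_pmul2r //.
  exact: adim_gt0.
apply/negPn/negP => d1; have := hd (adjoin_degree U x).
by rewrite sz dn andbT ltn_neqAle eq_sym d1 => /(_ isT).
Qed.

Lemma in_rat x : x \in 1%VS -> exists q : rat, x = q%:A.
Proof. by move/vlineP=> [q ->]; exists q. Qed.

Lemma rat_polyOver U (q : {poly rat}) : map_poly (in_alg K) q \is a polyOver U.
Proof.
apply/polyOverP => i; rewrite coef_map /= memvZ // mem1v //.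
Qed.

Lemma sqrt_rat x (a : rat) : odd (\dim {:K}) -> x ^+ 2 = a%:A ->
  exists q : rat, x = q%:A.
Proof.
move=> oK xa; apply: in_rat.
apply: (@root_in_subfield 1%AS x ('X^2 - a%:A%:P) (\dim {:K})).
- by rewrite rpredB ?rpredX ?polyOverX ?polyOverC ?memvZ ?mem1v.
- by rewrite -size_poly_eq0 size_XnsubC.
- by rewrite rootE !hornerE xa subrr.
- by rewrite dimv1 muln1.
- rewrite size_XnsubC // => -[|[|[|]]] // _; by rewrite dvdn2 oK.
Qed.

Lemma sqrt_rat_square x (a : rat) : odd (\dim {:K}) -> x ^+ 2 = a%:A ->
  exists q : rat, q ^+ 2 = a.
Proof.
move=> oK xa; have [q eq] := sqrt_rat oK xa; exists q.
by apply: (fmorph_inj (in_alg K)); rewrite /= -xa eq -!in_algE rmorphXn.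
Qed.

(** [2 * x + 1] would be a square root of -3, hence rational in odd degree. *)
Lemma no_omega x : odd (\dim {:K}) -> x ^+ 2 + x + 1 != 0.
Proof.
move=> oK; apply/eqP => e.
have [//||q e3] := @sqrt_rat_square (x *+ 2 + 1) (-3%:R).
  rewrite -in_algE rmorphN rmorph_nat.
  have -> : (x *+ 2 + 1) ^+ 2 = (x ^+ 2 + x + 1) *+ 4 - 3%:R by ring.
  by rewrite e mul0rn add0r.
by have := sqr_ge0 q; rewrite e3.
Qed.

Lemma cube_root_uniq x y : odd (\dim {:K}) -> x ^+ 3 = y ^+ 3 -> x = y.
Proof.
move=> oK e; apply/eqP; rewrite -subr_eq0; apply/negPn/negP => d.
have y0 : y != 0.
  apply: contraNneq d => y0; move/eqP: e.
  by rewrite y0 expr0n /= expf_eq0 /= => /eqP->; rewrite subrr.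
have := no_omega (x / y) oK; move/negP; apply; apply/eqP; apply: (mulIf d).
have -> : ((x / y) ^+ 2 + x / y + 1) * (x - y) = (x ^+ 3 - y ^+ 3) / y ^+ 2 by field.
by rewrite e subrr !mul0r.
Qed.

Lemma minPoly_rat x : exists m : {poly rat}, minPoly 1 x = map_poly (in_alg K) m.
Proof. by have /polyOver1P[m ->] := minPolyOver 1%AS x; exists m. Qed.

Lemma dim_adjoin_root x (q : {poly rat}) :
  irreducible_poly q -> root (map_poly (in_alg K) q) x -> \dim <<1; x>> = (size q).-1.
Proof.
move=> iq qx; rewrite dim_Fadjoin dimv1 muln1 -[LHS]/((adjoin_degree 1%AS x).+1.-1).
rewrite -size_minPoly; have [m em] := minPoly_rat x; rewrite em size_map_poly.
congr (_.-1); apply: eqp_size; apply: iq.2.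
  by rewrite -(size_map_poly (in_alg K)) -em size_minPoly.
by rewrite -(dvdp_map (in_alg K)) -em minPoly_dvdp // rat_polyOver.
Qed.

Lemma cubic_poly_props (U : {subfield K}) (u v : K) : u \in U -> v \in U ->
  let q := 'X^3 + (u *: 'X^2 + v%:P) in
  [/\ q \is a polyOver U, size q = 4%N & q != 0].
Proof.
move=> uU vU q; have sz : size q = 4%N.
  rewrite size_polyDl size_polyXn // (leq_ltn_trans (size_polyD _ _)) // gtn_max.
  rewrite (leq_ltn_trans (size_scale_leq _ _)) ?size_polyXn //=.
  by rewrite (leq_ltn_trans (size_polyC_leq1 _)).
split=> //; last by rewrite -size_poly_eq0 sz.
by rewrite !rpredD ?rpredX ?polyOverX ?polyOverZ ?polyOverC ?rpredX ?polyOverX.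
Qed.

(** Rational root test: in lowest terms the denominator is 1 and the numerator divides 1, and
    neither unit is a root. *)
Lemma rat_cubic_no_root (q : rat) : q ^+ 3 != q ^+ 2 *+ 3 - 1.
Proof.
apply/eqP => e; have := coprime_num_den q.
set a := numq q; set b := denq q => cab0.
have b0 : (b%:~R : rat) != 0 by rewrite intr_eq0 denq_neq0.
have eab : a ^+ 3 + b ^+ 3 = a ^+ 2 * b *+ 3.
  apply: (@intr_inj rat).
  rewrite !(rmorphD, rmorphMn, rmorphM, rmorphXn) /=.
  have -> : (a%:~R : rat) = q * b%:~R by rewrite -{1}[q]divq_num_den divfK.
  rewrite exprMn e; ring.
have cab : coprimez b (a ^+ 3).
  by rewrite coprimezXr // coprimezE coprime_sym.
have : (b %| a ^+ 3)%Z.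
  by apply/dvdzP; exists (a ^+ 2 *+ 3 - b ^+ 2); rewrite -[LHS](addrK (b ^+ 3)) eab; ring.
rewrite -[a ^+ 3]mulr1 Gauss_dvdzr // dvdz1 => /eqP b1.
have eb : b = 1 by rewrite -[b]gez0_abs ?b1 // ltW // denq_gt0.
move: eab; rewrite eb expr1n mulr1 => ea.
have : (a %| 1)%Z.
  apply/dvdzP; exists (a *+ 3 - a ^+ 2).
  have -> : (a *+ 3 - a ^+ 2) * a = a ^+ 2 *+ 3 - a ^+ 3.
    by move: (a) => z; ring.
  by rewrite -ea addrAC subrr add0r.
rewrite dvdz1 => /eqP a1; case: (ger0P a) => [/gez0_abs|/ltz0_abs]; rewrite a1 => ha.
  by move: ea; rewrite -ha.
by move: ea; rewrite -[a]opprK -ha.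
Qed.

(** * The cyclic cubic field of conductor 9 *)

Section CubicSubfield.

Variable w : K.
Hypothesis w_root : w ^+ 3 = w ^+ 2 *+ 3 - 1.

Definition cubic_field : {subfield K} := <<1; w>>%AS.

Lemma dim_cubic_field : \dim cubic_field = 3%N.
Proof.
pose q : {poly rat} := 'X^3 + (- 3%:R *: 'X^2 + 1%:P).
have sq : size q = 4%N.
  rewrite size_polyDl size_polyXn // (leq_ltn_trans (size_polyD _ _)) // gtn_max.
  by rewrite (leq_ltn_trans (size_scale_leq _ _)) ?size_polyXn // size_polyC.
rewrite (@dim_adjoin_root w q) ?sq //.
  apply: cubic_irreducible => [|x]; first by rewrite sq.
  apply: contra (rat_cubic_no_root x); rewrite rootE !hornerE /= => /eqP e.
  by rewrite -subr_eq0 -[X in _ == X]e; apply/eqP; ring.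
have -> : map_poly (in_alg K) q = 'X^3 + ((- 3%:R)%:A *: 'X^2 + (1%:A)%:P).
  by rewrite /q !rmorphD /= map_polyXn map_polyC map_polyZ map_polyXn.
rewrite rootE !hornerE /= w_root.
rewrite -!in_algE rmorphN rmorph_nat rmorph1; apply/eqP; ring.
Qed.

Variable p : nat.
Hypotheses (p_prime : prime p) (p_ge5 : (5 <= p)%N) (dimK : \dim {:K} = (3 * p)%N).

Let oddK : odd (\dim {:K}). Proof. by rewrite dimK odd_mul3_prime. Qed.

(* Every prime factor of [K : Q(w)] = p is at least 5, so Q(w) is closed under
   taking roots of cubics in K. *)
Lemma cubic_root_in_cubic_field (u v x : K) :
  u \in cubic_field -> v \in cubic_field -> x ^+ 3 + u * x ^+ 2 + v = 0 ->
  x \in cubic_field.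
Proof.
move=> uU vU ex; have [qU sz q0] := cubic_poly_props uU vU.
apply: (root_in_subfield (n := p) qU q0).
- by rewrite rootE !hornerE /= -mulrA -expr2 ex.
- by rewrite dimK dim_cubic_field mulnC.
rewrite sz => d /andP[d1 d4]; apply/negP => /(@prime_nt_dvdP _ _ p_prime).
move/(_ _)=> ed; have := p_ge5; rewrite -ed ?(leqNgt 5) ?(ltn_trans d4) // neq_ltn d1 orbT //.
Qed.

Lemma cubic_field_coords x : x \in cubic_field ->
  exists a b c : rat, x = a%:A + b%:A * w + c%:A * w ^+ 2.
Proof.
move=> xU; have := Fadjoin_poly_eq xU; have := Fadjoin_polyOver 1%AS w x.
have := size_Fadjoin_poly 1%AS w x.
have -> : adjoin_degree 1%AS w = 3%N.
  by have := dim_cubic_field; rewrite dim_Fadjoin dimv1 muln1.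
move: (Fadjoin_poly _ _ _) => q sq qU <-.
have [[a ea] [b eb] [c ec]] : [/\ exists a : rat, q`_0 = a%:A,
   exists a : rat, q`_1 = a%:A & exists a : rat, q`_2 = a%:A].
  by split; apply: in_rat; apply: (polyOverP qU).
exists a, b, c; rewrite -ea -eb -ec (horner_coef_wide _ sq).
by rewrite !big_ord_recl big_ord0 /= expr0 mulr1 addr0 expr1 addrA.
Qed.

Lemma cubic_field_indep (a b c : rat) :
  a%:A + b%:A * w + c%:A * w ^+ 2 = 0 -> [/\ a = 0, b = 0 & c = 0].
Proof.
move=> e; pose q : {poly K} := Poly [:: a%:A; b%:A; c%:A].
have q0 : q = 0.
  apply/eqP/negPn/negP => q0.
  have : (size (minPoly 1%AS w) <= size q)%N.
    rewrite dvdp_leq // minPoly_dvdp //.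
      apply/polyOverP => i; rewrite coef_Poly.
      by case: i => [|[|[|i]]] /=; rewrite ?nth_nil ?rpred0 // memvZ ?mem1v.
    rewrite rootE horner_Poly /=; apply/eqP; rewrite -[RHS]e.
    by move: (a%:A) (b%:A) (c%:A) => ? ? ?; ring.
  rewrite size_minPoly; have := dim_cubic_field; rewrite dim_Fadjoin dimv1 muln1 => ->.
  by rewrite ltnNge size_Poly.
have cf i : q`_i = 0 by rewrite q0 coef0.
have inj0 (z : rat) : z%:A = 0 :> K -> z = 0.
  by move/eqP; rewrite scaler_eq0 oner_eq0 orbF => /eqP.
by split; apply: inj0; [move: (cf 0%N) | move: (cf 1%N) | move: (cf 2%N)];
  rewrite coef_Poly.
Qed.

Lemma form_alg (w1 : K) (a b c n : rat) (u := a%:A + b%:A * w1 + c%:A * w1 ^+ 2) :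
  w1 ^+ 3 = w1 ^+ 2 *+ 3 - 1 ->
  (form0 a b c n)%:A + (form1 a b c n)%:A * w1 + (form2 a b c n)%:A * w1 ^+ 2
  = u ^+ 3 - n%:A * w1 * u ^+ 2 *+ 3 - n%:A ^+ 3.
Proof.
move=> e1; have [e10 e11 e12] := form_rmorph (in_alg K) a b c n.
by rewrite -!in_algE -e10 -e11 -e12 formE.
Qed.

Lemma form_cubic_field (a b c n : rat) (u := a%:A + b%:A * w + c%:A * w ^+ 2) :
  u ^+ 3 = n%:A * w * u ^+ 2 *+ 3 + n%:A ^+ 3 ->
  [/\ form0 a b c n = 0, form1 a b c n = 0 & form2 a b c n = 0].
Proof.
move=> eu; apply: cubic_field_indep.
by rewrite form_alg // -/u eu addrAC addrK subrr.
Qed.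

(* The conjugation [w |-> 2 + 2 w - w^2] of the cubic field maps a cube root of a
   rational to another one, hence fixes it. *)
Lemma cube_rat (x : K) (k : rat) : x ^+ 3 = k%:A -> exists q : rat, x = q%:A.
Proof.
move=> xk; have [|a [b [c ec]]] := @cubic_field_coords x.
  apply: (cubic_root_in_cubic_field (rpred0 _) (v := - k%:A)).
    by rewrite rpredN memvZ // rpred1.
  by rewrite xk mul0r addr0 subrr.
have simp (z y : K) : z ^+ 3 - 0%:A * y * z ^+ 2 *+ 3 - 0%:A ^+ 3 = z ^+ 3.
  by rewrite scale0r !mul0r mul0rn expr0n !subr0.
(* For [n = 0] the three forms are the coordinates of the cube. *)
have [g0 g1 g2] : [/\ form0 a b c 0 - k = 0, form1 a b c 0 = 0 & form2 a b c 0 = 0].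
  apply: cubic_field_indep; rewrite scalerBl -xk ec -(simp _ w) -(form_alg a b c 0 w_root).
  by ring.
pose w' := w *+ 2 - w ^+ 2 + 2%:R.
have w'_root : w' ^+ 3 = w' ^+ 2 *+ 3 - 1 by rewrite /w'; ring: w_root.
have ec' : x = a%:A + b%:A * w' + c%:A * w' ^+ 2.
  apply: cube_root_uniq => //; rewrite xk -(simp _ w') -form_alg // g1 g2 !scale0r.
  by rewrite !mul0r !addr0; congr (_%:A); apply/esym/eqP; rewrite -subr_eq0 g0.
(* Coordinates of the difference of the two expressions of [x]; the last two add up to [3 * c]. *)
have [_ h1 h2] : [/\ b *+ 2 + c *+ 5 = 0, b + c *+ 7 = 0 & b *- 1 - c *+ 4 = 0].
  apply: cubic_field_indep.
  move/eqP: ec'; rewrite {1}ec -subr_eq0 => /eqP e'.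
  rewrite -[RHS]oppr0 -e' -!in_algE !(rmorphD, rmorphN, rmorphMn) /= /w'; ring: w_root.
have c0 : c = 0.
  have e3 : c *+ 3 = (b + c *+ 7) + (b *- 1 - c *+ 4) by ring.
  by move/eqP: e3; rewrite h1 h2 addr0; rewrite -mulr_natl mulf_eq0 => /orP[//|/eqP].
have b0 : b = 0 by move: h1; rewrite c0 mul0rn addr0.
by exists a; rewrite ec b0 c0 !scale0r !mul0r !addr0.
Qed.

(** A root lies in the cubic field; its coordinates over a common denominator [d] form an integral
    zero of the three forms with [n = d], which forces [d = 0]. *)
Lemma no_27_division (x : K) : x ^+ 3 != w * x ^+ 2 *+ 3 + 1.
Proof.
apply/eqP => ex.
have [|a [b [c ec]]] := @cubic_field_coords x.
  apply: (cubic_root_in_cubic_field (u := - (w *+ 3)) (v := -1)).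
  - by rewrite rpredN rpredMn ?memv_adjoin.
  - by rewrite rpredN rpred1.
  - by rewrite ex; ring.
pose d := denq a * denq b * denq c.
pose A := numq a * denq b * denq c; pose B := denq a * numq b * denq c.
pose C := denq a * denq b * numq c.
have eA : A%:~R = d%:~R * a.
  by rewrite !rmorphM /= numqE; ring.
have eB : B%:~R = d%:~R * b.
  by rewrite !rmorphM /= numqE; ring.
have eC : C%:~R = d%:~R * c.
  by rewrite !rmorphM /= numqE; ring.
have d0 : d != 0 by rewrite !mulf_neq0 ?denq_neq0.
have [] := @form_cubic_field A%:~R B%:~R C%:~R d%:~R.
  set u := _ + _ + _; have -> : u = (d%:~R)%:A * x.
    by rewrite /u eA eB eC ec -!in_algE !rmorphM /=; ring.
  by rewrite !exprMn ex; ring.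
have [-> -> ->] := form_rmorph (intr : {rmorphism int -> rat}) A B C d.
move/eqP; rewrite intr_eq0 => /eqP f0 /eqP; rewrite intr_eq0 => /eqP f1.
move/eqP; rewrite intr_eq0 => /eqP f2.
by rewrite (form_int_eq0 f0 f1 f2) eqxx in d0.
Qed.

End CubicSubfield.

End NumberField.

Lemma natrK_neq0 (K : fieldExtType rat) n : (n.+1%:R : K) != 0.
Proof. by rewrite -(rmorph_nat (in_alg K)) fmorph_eq0 pnatr_eq0. Qed.

(** Valuations of an [n]-th power are multiples of [n]; this serves to show that given integers are
    not rational squares or cubes. *)
Lemma rat_power_logn (q : rat) (z : int) (n l : nat) :
  z != 0 -> q ^+ n = z%:~R -> (n %| logn l `|z|)%N.
Proof.
move=> z0 e; have d0 : (0 < `|denq q|)%N by rewrite absz_gt0 denq_neq0.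
have e2 : numq q ^+ n = z * denq q ^+ n.
  by apply: (@intr_inj rat); rewrite rmorphM !rmorphXn /= -e numqE exprMn.
have /(congr1 (fun u => logn l `|u|)) := e2.
rewrite abszM !abszX lognM ?expn_gt0 ?d0 ?absz_gt0 // !lognX => e3.
by rewrite -(dvdn_addl (n := n * logn l `|denq q|)) ?dvdn_mulr // -e3 dvdn_mulr.
Qed.

(** * Points of order 2, 3, 4, 9, 18 and 27 *)

Section Torsion3p.

Variables (K : fieldExtType rat) (p : nat) (c : rat).
Hypotheses (p_prime : prime p) (p_ge5 : (5 <= p)%N) (dimK : \dim {:K} = (3 * p)%N).
Variable sm : smooth (c%:A : K).
Notation E := (mordell_group sm).
Implicit Types P Q R : E.
Let cK : K := c%:A.

Let oddK : odd (\dim {:K}). Proof. by rewrite dimK odd_mul3_prime. Qed.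

Let three_neq0 : (3%:R : K) != 0. Proof. by case/and3P: sm. Qed.
Let c_neq0 : cK != 0. Proof. by case/and3P: sm. Qed.

Lemma order2_uniq P Q : P *+ 2 = 0 -> Q *+ 2 = 0 -> P != 0 -> Q != 0 -> P = Q.
Proof.
move=> P2 Q2 P0 Q0; have [x ex hx] := order2_point P2 P0.
have [y ey hy] := order2_point Q2 Q0.
apply: val_inj; rewrite ex ey; congr (Some (_, _)).
by apply: cube_root_uniq => //; rewrite hx hy.
Qed.

Lemma no_point_order4 P : P *+ 4 = 0 -> P *+ 2 = 0.
Proof.
move=> P4; apply/eqP/negPn/negP => P2.
have [u u3] := order4_sqrt3 P4 P2.
have [||q q3] := @sqrt_rat_square K u 3%:R => //; first by rewrite u3 -in_algE rmorph_nat.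
have := @rat_power_logn q 3 2 3 isT; rewrite q3 => /(_ (erefl _)).
by rewrite -[`|3|%N]/3%N.
Qed.

Lemma order3_uniq P Q : P *+ 3 = 0 -> Q *+ 3 = 0 -> P != 0 -> Q != 0 ->
  Q = P \/ Q = - P.
Proof.
move=> P3 Q3 P0 Q0; have [x [y [ex hy hx]]] := order3_point P3 P0.
have [x' [y' [ex' hy' hx']]] := order3_point Q3 Q0.
(* Abscissae of both kinds would make [c] and [- 3 * c] squares in [K], hence -3 a rational
   square. *)
have nsq (u v : K) : u ^+ 2 = cK -> v ^+ 2 = - (cK *+ 3) -> False.
  move=> hu hv; have u0 : u != 0.
    by apply: contraNneq c_neq0 => u0; rewrite -hu u0 expr0n.
  have [||q q3] := @sqrt_rat_square K (v / u) (- 3%:R) => //.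
    by rewrite expr_div_n hu hv -in_algE rmorphN rmorph_nat; field.
  by have := sqr_ge0 q; rewrite q3.
have exx : x = x'.
  case: hx hx' => hx [] hx'; first by rewrite hx hx'.
  - exfalso; apply: (nsq y y'); first by rewrite hy hx expr0n add0r.
    by rewrite hy' hx' -/cK; ring.
  - exfalso; apply: (nsq y' y); first by rewrite hy' hx' expr0n add0r.
    by rewrite hy hx -/cK; ring.
  by apply: cube_root_uniq => //; rewrite hx hx'.
have /eqP : y' ^+ 2 = y ^+ 2 by rewrite hy hy' exx.
rewrite eqf_sqr => /orP[] /eqP ey; [left|right]; apply: val_inj.
  by rewrite ex ex' ey exx.
by rewrite val_oppr ex' ey ex exx.
Qed.

(** Let [a] be the abscissa of [3 R]. If [a = 0], the cubics of [triple_coords] give [v = X / 3] and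
    [w = x / v]. If [a ^ 3 = - 4 * c], then [z = X / (3 * a)] is a root of the cubic of [w] and
    [x / a] contradicts [no_27_division]. *)
Lemma order9_point R : R *+ 9 = 0 -> R *+ 3 != 0 -> exists w v y,
  [/\ w ^+ 3 = w ^+ 2 *+ 3 - 1, v ^+ 3 = cK *+ 4, v != 0 & val (R : mordell cK) = Some (v * w, y)].
Proof.
move=> R9 R3; have R0 : R != 0 by apply: contraNneq R3 => ->; rewrite mul0rn.
have R2 : R *+ 2 != 0.
  apply: contraNneq R0 => R2; rewrite -R9 -[9%N]/(1 + 2 * 4)%N mulrnDr mulrnA R2.
  by rewrite mul0rn addr0.
have Q3 : R *+ 3 *+ 3 = 0 by rewrite -mulrnA.
have [a [b [eab hb ha]]] := order3_point Q3 R3.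
have [x [y [exy _]]] := coords R0.
have [X [x0 X0 hX hx]] := triple_coords exy R2 eab.
case: ha => ha.
  pose v := X / 3%:R; have v0 : v != 0 by rewrite mulf_neq0 ?invr_eq0.
  have hv : v ^+ 3 = cK *+ 4.
    by rewrite expr_div_n hX ha mul0r mul0rn add0r -/cK; field; rewrite natrK_neq0.
  exists (x / v), v, y; split=> //; last by rewrite mulrC divfK.
  apply: (mulIf (expf_neq0 3 v0)); rewrite -exprMn divfK // hx.
  have -> : X = v * 3%:R by rewrite divfK.
  by rewrite -/cK -hv; field.
have a0 : a != 0.
  apply: contraNneq c_neq0 => a0; move/eqP: ha.
  by rewrite a0 expr0n eq_sym oppr_eq0 -mulr_natr mulf_eq0 (negPf (natrK_neq0 K 3)) orbF.
pose z := X / (a *+ 3).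
have n4 : (4%:R : K) != 0 := natrK_neq0 K 3.
have hc : cK = - (a ^+ 3 / 4%:R).
  by rewrite ha -/cK; field.
have eX : X = z * (a *+ 3) by rewrite divfK // -mulr_natr mulf_neq0.
have hz : z ^+ 3 = z ^+ 2 *+ 3 - 1.
  have k0 : a ^+ 3 *+ 27 != 0.
    by rewrite -mulr_natr -[27%N]/(3 ^ 3)%N natrX mulf_neq0 ?expf_neq0.
  apply: (mulIf k0); have -> : z ^+ 3 * (a ^+ 3 *+ 27) = X ^+ 3 by rewrite eX; ring.
  by rewrite hX eX -/cK hc; field.
have := no_27_division hz p_prime p_ge5 dimK (x / a); case/eqP.
apply: (mulIf (expf_neq0 3 a0)); rewrite -exprMn divfK // hx eX -/cK hc; field.
by rewrite a0 n4.
Qed.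

(** [3 P] has abscissa [v * w] with [v ^ 3 = 4 * c], so [X / (3 * v)] would solve the cubic excluded
    by [no_27_division]. *)
Lemma no_point_order27 P : P *+ 27 = 0 -> P *+ 9 = 0.
Proof.
move=> P27; apply/eqP/negPn/negP => P9.
have [||w [v [b [hw hv v0 eab]]]] := @order9_point (P *+ 3); rewrite -?mulrnA //.
have P0 : P != 0 by apply: contraNneq P9 => ->; rewrite mul0rn.
have P2 : P *+ 2 != 0.
  apply: contraNneq P0 => P2; rewrite -P27 -[27%N]/(1 + 2 * 13)%N mulrnDr mulrnA P2.
  by rewrite mul0rn addr0.
have [x [y [exy _]]] := coords P0.
have [X [x0 X0 hX hx]] := triple_coords exy P2 eab.
have := no_27_division hw p_prime p_ge5 dimK (X / (v *+ 3)); case/eqP.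
have n3 : v *+ 3 != 0 by rewrite -mulr_natr mulf_neq0.
apply: (mulIf (expf_neq0 3 n3)); rewrite -exprMn divfK // hX.
have -> : c%:A *+ 108 = v ^+ 3 *+ 27 by rewrite hv; ring.
by field; rewrite v0 three_neq0.
Qed.

(** The quotient of [v], where [v ^ 3 = 4 * c], by the abscissa [t] of [Q], where [t ^ 3 = - c],
    would be a cube root of -4, hence rational. *)
Lemma no_point_order18 P Q : P *+ 9 = 0 -> Q *+ 2 = 0 -> Q != 0 -> P *+ 3 = 0.
Proof.
move=> P9 Q2 Q0; apply/eqP/negPn/negP => P3.
have [w [v [b [hw hv v0 _]]]] := order9_point P9 P3.
have [t _ ht] := order2_point Q2 Q0.
have t0 : t != 0.
  by apply: contraNneq c_neq0 => t0; rewrite -oppr_eq0 -ht t0 expr0n.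
have e : (v / t) ^+ 3 = (-4%:R)%:A.
  have -> : (- 4%:R : rat)%:A = - 4%:R :> K by rewrite -in_algE rmorphN rmorph_nat.
  rewrite expr_div_n hv ht -/cK; field.
  by rewrite oppr_eq0; exact: c_neq0.
have [q eq] := cube_rat hw p_prime p_ge5 dimK e.
have := @rat_power_logn q (-4) 3 2 isT.
have -> : q ^+ 3 = (-4)%:~R.
  by apply: (fmorph_inj (in_alg K)); rewrite rmorphXn /= -eq e.
by move=> /(_ (erefl _)).
Qed.

End Torsion3p.

(** * Reduction at finite places *)

(** An even [size] is an odd degree. Degrees add up, so one of any two complementary factors has odd
    degree. *)
Lemma odd_degree_factor (F : fieldType) (f : {poly F}) : f != 0 -> ~~ odd (size f) ->
  exists g, [/\ irreducible_poly g, g \is monic, g %| f & ~~ odd (size g)].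
Proof.
have [n] := ubnP (size f); elim: n f => // n IH f fn f0 ef.
have [irr|red] := classic (irreducible_poly f).
  have l0 : (lead_coef f)^-1 != 0 by rewrite invr_eq0 lead_coef_eq0.
  exists ((lead_coef f)^-1 *: f); split.
  - split=> [|q q1]; first by rewrite size_scale //; case: irr.
    rewrite dvdpZr // => /(irr.2 q q1) qf; apply: eqp_trans qf _.
    by rewrite eqp_sym eqp_scale.
  - by rewrite monicE lead_coefZ mulVf // lead_coef_eq0.
  - by rewrite dvdpZl ?dvdpp.
  - by rewrite size_scale.
have f2 : (1 < size f)%N.
  by move: f0 ef; rewrite -size_poly_gt0; case: (size f) => [|[|]].
have [q [q1 qf nqf]] : exists q : {poly F}, [/\ size q != 1%N, q %| f & ~~ (q %= f)].
  apply: NNPP => h; apply: red; split=> // q q1 qf; apply/negPn/negP => nqf.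
  by apply: h; exists q.
have sqf : (size q < size f)%N.
  by rewrite ltn_neqAle dvdp_leq // andbT; apply: contra nqf; rewrite dvdp_size_eqp.
case/dvdpP: (qf) => r er; move: f0; rewrite er mulf_eq0 negb_or => /andP[r0 q0].
have sf : (size f).+1 = (size r + size q)%N.
  by rewrite er size_mul // prednK // addn_gt0 size_poly_gt0 r0.
have q2 : (1 < size q)%N by rewrite ltn_neqAle eq_sym q1 size_poly_gt0.
case: (boolP (odd (size q))) => oq.
  have [|//||g [ig mg gr og]] := IH r.
  - by lia.
  - by move: (congr1 odd sf); rewrite /= oddD oq addbT => /negb_inj <-.
  exists g; split=> //; first by rewrite dvdp_mulr.
have [|//||g [ig mg gr og]] := IH q => //; first by lia.
by exists g; split=> //; rewrite dvdp_mull.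
Qed.

(** A primitive element [t] with an integral multiple [f] of its minimal polynomial such that [Z[t]]
    is [Z[X]] modulo [f]. *)
Lemma int_poly_generator (K : fieldExtType rat) :
  exists (t : K) (f : {poly int}),
  [/\ size f = (\dim {:K}).+1,
      forall h : {poly int}, (map_poly intr h).[t] = 0 -> exists r, h = f * r
    & forall z : K, exists (h : {poly int}) (D : int),
        D != 0 /\ D%:~R * z = (map_poly intr h).[t]].
Proof.
have sep : separable 1%AS {:K}%AS.
  by apply/separableP => y _; apply: pcharf0_separable => q; rewrite pchar_lalg pchar_num.
have gen := eq_adjoin_separable_generator sep (sub1v _).
set t := separable_generator _ _ in gen.
have [m em] := minPoly_rat t.
have [m' [a a0 em']] := rat_poly_scale m.
have hZ (h : {poly int}) : map_poly intr h = map_poly (in_alg K) (map_poly intr h).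
  by rewrite -map_poly_comp; apply: eq_map_poly => z /=; rewrite -in_algE rmorph_int.
(* Primitive, so that by Gauss's lemma divisibility by [f] over the rationals holds over the
   integers. *)
pose f := zprimitive m'; exists t, f.
have mt : size (minPoly 1 t) = (\dim {:K}).+1.
  by rewrite size_minPoly; have := dim_Fadjoin 1%AS t; rewrite dimv1 muln1 -gen => ->.
split.
- rewrite size_zprimitive -mt em size_map_poly em' size_scale ?invr_eq0 ?intr_eq0 //.
  by rewrite size_map_inj_poly //; apply: intr_inj.
- move=> h ht; have : m %| map_poly intr h.
    rewrite -(dvdp_map (in_alg K)) -em -hZ minPoly_dvdp ?rootE ?ht //.
    by rewrite hZ; apply/polyOverP => i; rewrite coef_map /= memvZ // mem1v.
  rewrite em' dvdpZl ?invr_eq0 ?intr_eq0 // dvdp_rat_int => /dvdpP_int[r ->].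
  by exists r.
- move=> z; have zt : z \in <<1; t>>%VS by rewrite -gen memvf.
  have /polyOver1P[q eq] := Fadjoin_polyOver 1%AS t z.
  have [q' [b b0 eq']] := rat_poly_scale q; exists q', b; split=> //.
  rewrite -(Fadjoin_poly_eq zt) eq eq' hZ map_polyZ hornerZ /=.
  rewrite mulrA -[b%:~R in X in X * _](rmorph_int (in_alg K)) -in_algE -rmorphM.
  by rewrite divff ?intr_eq0 // rmorph1 mul1r.
Qed.

(* A partial ring morphism [K -> F], as a functional relation. *)
Record place (K F : fieldType) (r : K -> F -> Prop) : Prop := Place {
  place1 : r 1 1;
  placeB : forall x y u v, r x u -> r y v -> r (x - y) (u - v);
  placeM : forall x y u v, r x u -> r y v -> r (x * y) (u * v);
  place0_eq : forall u, r 0 u -> u = 0 }.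

(** The residue field is [F_l[X]] modulo an irreducible factor of odd degree of [f] modulo [l]. *)
Lemma finite_place (K : fieldExtType rat) (s : seq K) : odd (\dim {:K}) ->
  exists2 N : nat, (0 < N)%N & forall l, prime l -> ~~ (l %| N)%N ->
  exists (F : finFieldType) (r : K -> F -> Prop) (k : nat),
  [/\ place r, odd k, #|F| = (l ^ k)%N & forall z, z \in s -> exists u, r z u].
Proof.
move=> oK; have [t [f [sf fker gen]]] := int_poly_generator K.
have f0 : f != 0 by rewrite -size_poly_gt0 sf.
have [N N0 Ns] : exists2 N : int, N != 0 & forall z, z \in s ->
    exists (h : {poly int}) (D : int), (D %| N)%Z /\ D%:~R * z = (map_poly intr h).[t].
  elim: s => [|z s [N N0 IH]]; first by exists 1.
  have [h [D [D0 eh]]] := gen z; exists (D * N); first by rewrite mulf_neq0.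
  move=> y; rewrite inE => /predU1P[->|/IH[h' [D' [D'N e']]]].
    by exists h, D; rewrite dvdz_mulr.
  by exists h', D'; rewrite dvdz_mull.
(* Primes outside this number preserve the degree of [f] and invert the denominators of the elements
   of [s]. *)
exists `|(lead_coef f * N)%R|%N; first by rewrite absz_gt0 mulf_neq0 ?lead_coef_eq0.
move=> l pl lN.
have ndvd (D : int) : (D %| lead_coef f * N)%Z -> D%:~R != 0 :> 'F_l.
  by move=> DN; apply: contra lN; rewrite -(dvdz_pcharf (pchar_Fp pl)) => /dvdz_trans; apply.
pose fl : {poly 'F_l} := map_poly intr f.
have szl : size fl = (\dim {:K}).+1.
  by rewrite /fl size_map_poly_id0 ?sf // ndvd // dvdz_mulr.
have fl0 : fl != 0 by rewrite -size_poly_gt0 szl.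
have [|g [ig mg gf og]] := odd_degree_factor fl0; first by rewrite szl /= negbK.
pose F : finFieldType := {poly %/ g with (ig, mg)}.
pose e : {poly int} -> F := fun h => in_qpoly g (map_poly intr h : {poly 'F_l}).
have eM (h h' : {poly int}) : e (h * h') = e h * e h'.
  by rewrite /e rmorphM /= in_qpolyM.
have eB (h h' : {poly int}) : e (h - h') = e h - e h'.
  by rewrite /e rmorphB /= raddfB.
have eZ (D : int) : e D%:~R = D%:~R by rewrite /e rmorph_int rmorph_int.
have ef : e f = 0.
  have := gf; rewrite /e -/fl => /dvdpP[q ->]; rewrite in_qpolyM.
  suff -> : in_qpoly g g = 0 by rewrite mulr0.
  by apply/val_inj; rewrite /= mk_monicE // Pdiv.RingMonic.rmodpp.
have nzF (D : int) : (D %| lead_coef f * N)%Z -> D%:~R != 0 :> F.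
  move=> DN; rewrite -(rmorph_int (in_alg F)) fmorph_eq0; exact: ndvd.
pose v (h : {poly int}) : K := (map_poly intr h).[t].
have vM (h h' : {poly int}) : v (h * h') = v h * v h' by rewrite /v rmorphM hornerM.
have vB (h h' : {poly int}) : v (h - h') = v h - v h'.
  by rewrite /v rmorphB hornerD hornerN.
have vZ (D : int) : v D%:~R = D%:~R.
  by rewrite /v rmorph_int; exact: (rmorph_int (horner_eval t)).
(* Reduction of fractions: [z = h(t) / D] goes to the class of [h] divided by [D], where [D] is
   nonzero in [F]. *)
exists F, (fun z u => exists (h : {poly int}) (D : int),
   [/\ D%:~R != 0 :> F, D%:~R * z = v h & D%:~R * u = e h]), (size g).-1.
split.
- split.
  + by exists 1, 1; rewrite !mulr1 oner_neq0 -(vZ 1) -(eZ 1).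
  + move=> x y u u' [h [D [D0 ex eu]]] [h' [D' [D'0 ey eu']]].
    exists (D'%:~R * h - D%:~R * h'), (D * D'); split.
    * by rewrite rmorphM mulf_neq0.
    * by rewrite vB !vM !vZ -ex -ey rmorphM /=; ring.
    * by rewrite eB !eM !eZ -eu -eu' rmorphM /=; ring.
  + move=> x y u u' [h [D [D0 ex eu]]] [h' [D' [D'0 ey eu']]].
    exists (h * h'), (D * D'); split.
    * by rewrite rmorphM mulf_neq0.
    * by rewrite !vM -ex -ey rmorphM /=; ring.
    * by rewrite !eM -eu -eu' rmorphM /=; ring.
  + move=> u [h [D [D0 ex eu]]]; apply: (mulfI D0).
    rewrite mulr0 eu; move: ex; rewrite mulr0 => /esym/fker[r ->].
    by rewrite eM ef mul0r.
- by have g1 : (1 < size g)%N := ig.1; move: og g1; case: (size g) => [|n] //=; rewrite negbK.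
- by rewrite card_qfpoly card_Fp.
- move=> z /Ns[h [D [DN eh]]]; have D0 : D%:~R != 0 :> F by apply: nzF; rewrite dvdz_mull.
  by exists (e h / D%:~R), h, D; split; rewrite // mulrC divfK.
Qed.

(** * Reduction of points *)

Section PlaceTheory.

Variables (K F : fieldType) (r : K -> F -> Prop) (pr : place r).

Lemma place0 : r 0 0.
Proof. by rewrite -(subrr (1 : K)) -(subrr (1 : F)); apply: (placeB pr); apply: (place1 pr). Qed.

Lemma placeN x u : r x u -> r (- x) (- u).
Proof. by rewrite -[- x]sub0r -[- u]sub0r; move/(placeB pr place0). Qed.

Lemma placeD x y u v : r x u -> r y v -> r (x + y) (u + v).
Proof.
by move=> hx hy; rewrite -[y]opprK -[v]opprK; apply: (placeB pr) => //; apply: placeN.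
Qed.

Lemma placeMn x u n : r x u -> r (x *+ n) (u *+ n).
Proof.
by move=> hx; elim: n => [|n IH]; [exact: place0 | rewrite !mulrS; apply: placeD].
Qed.

Lemma place_inj x u v : r x u -> r x v -> u = v.
Proof.
move=> hu hv; apply/eqP; rewrite -subr_eq0; apply/eqP/(place0_eq pr).
by rewrite -(subrr x); apply: (placeB pr).
Qed.

Lemma placeV x u : x != 0 -> (exists v, r x^-1 v) -> r x u -> u != 0 /\ r x^-1 u^-1.
Proof.
move=> x0 [v hv] hu; have e : u * v = 1.
  by apply: (@place_inj 1); [rewrite -(mulfV x0); apply: (placeM pr) | exact: (place1 pr)].
have u0 : u != 0 by apply: contraTneq (oner_neq0 F) => u0; rewrite -e u0 mul0r eqxx.
by split=> //; rewrite -[u^-1]mulr1 -e mulKf.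
Qed.

Definition point_rel (P : option (K * K)) (Q : option (F * F)) : Prop :=
  match P, Q with
  | None, None => True
  | Some (x, y), Some (u, v) => r x u /\ r y v
  | _, _ => False
  end.

(** When the inverses of the slope denominators can be reduced, nonzero denominators stay nonzero,
    and both additions take the same branch. *)
Lemma point_rel_add (c : K) x1 y1 u1 v1 Q Q' :
  on_mordell c (Some (x1, y1)) -> on_mordell c Q ->
  r x1 u1 -> r y1 v1 -> point_rel Q Q' ->
  (exists v, r (y1 *+ 2)^-1 v) ->
  (if Q is Some (x2, _) then exists v, r (x2 - x1)^-1 v else True) ->
  point_rel (raw_add (Some (x1, y1)) Q) (raw_add (Some (u1, v1)) Q').
Proof.
move=> oP; case: Q Q' => [[x2 y2]|] [[u2 v2]|] // oQ hx hy.
case=> hx2 hy2 hd hdx.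
have fin s s' : r s s' -> point_rel (Some (s ^+ 2 - x1 - x2, s * (x1 - (s ^+ 2 - x1 - x2)) - y1))
    (Some (s' ^+ 2 - u1 - u2, s' * (u1 - (s' ^+ 2 - u1 - u2)) - v1)).
  by move=> hs; split; do ?[apply: (placeB pr) => // | apply: (placeM pr) => //].
case: (eqVneq x1 x2) => [ex|nx].
  rewrite -ex in oQ hx2; have eu := place_inj hx hx2.
  rewrite /= /slope ex -eu !eqxx /=; rewrite -ex.
  case: (eqVneq y1 (- y2)) => [ey|ny].
    have -> : v1 = - v2 by apply: (@place_inj y1) => //; rewrite ey; apply: placeN.
    by rewrite eqxx.
  have y12 : y1 = y2 by case: (mordell_ord oP oQ) => // ey; rewrite ey eqxx in ny.
  have v12 : v1 = v2 by apply: (@place_inj y1) => //; rewrite y12.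
  have y10 : y1 *+ 2 != 0 by rewrite mulr2n addr_eq0 {2}y12.
  have [v10 hV] := placeV y10 hd (placeMn 2 hy).
  have nv : v1 == - v2 = false by rewrite -v12 -addr_eq0 -mulr2n (negPf v10).
  rewrite nv eu; rewrite eu in fin; have := fin (x1 ^+ 2 *+ 3 / (y1 *+ 2)).
  rewrite -ex -eu; apply; apply: (placeM pr) => //.
  by apply: placeMn; apply: (placeM pr).
have dx : x2 - x1 != 0 by rewrite subr_eq0 eq_sym.
have [du hV] := placeV dx hdx (placeB pr hx2 hx).
have nu : u1 != u2 by rewrite eq_sym -subr_eq0.
rewrite /= /slope (negPf nx) (negPf nu) /=; apply: fin.
by apply: (placeM pr) => //; apply: (placeB pr).
Qed.

End PlaceTheory.

Lemma torsion_point_reduction (K : fieldExtType rat) (c : K) (sm : smooth c) q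
    (P : mordell_group sm) :
  odd (\dim {:K}) -> P *+ q = 0 -> P != 0 ->
  exists2 N : nat, (0 < N)%N & forall l, prime l -> ~~ (l %| N)%N ->
  exists (F : finFieldType) (c' : F) (sm' : smooth c') (P' : mordell_group sm') k,
  [/\ odd k, #|F| = (l ^ k)%N, P' *+ q = 0 & P' != 0].
Proof.
move=> oK Pq; rewrite val_eq0; case eP: (val (P : mordell c)) => [[x y]|] // _.
(* All that must reduce: the constants ensuring smoothness, the point, and the inverses of the slope
   denominators met in computing [P *+ i] for [i <= q]. *)
pose s := [:: 2%:R; 2%:R^-1; 3%:R; 3%:R^-1; c; c^-1; x; y; (y *+ 2)^-1]
  ++ [seq (if val (P *+ i : mordell c) is Some (x2, _) then (x2 - x)^-1 else 0)
     | i <- iota 0 q].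
have [N N0 HN] := finite_place s oK; exists N => // l pl lN.
have [F [r [k [pr ok cF dom]]]] := HN l pl lN.
have [c' hc'] : exists u, r c u by apply: dom; rewrite !inE eqxx !orbT.
have [u hu] : exists u, r x u by apply: dom; rewrite !inE eqxx !orbT.
have [v hv] : exists u, r y u by apply: dom; rewrite !inE eqxx !orbT.
have [K2 K3 Kc] := and3P sm.
have sm' : smooth c'.
  have h n : r n%:R n%:R by apply: (placeMn pr); apply: (place1 pr).
  apply/and3P; split.
  - by apply: (placeV pr K2 _ (h _)).1; apply: dom; rewrite !inE eqxx !orbT.
  - by apply: (placeV pr K3 _ (h _)).1; apply: dom; rewrite !inE eqxx !orbT.
  - by apply: (placeV pr Kc _ hc').1; apply: dom; rewrite !inE eqxx !orbT.
have oP : on_mordell c (Some (x, y)) by rewrite -eP; apply: (valP (P : mordell c)).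
have oP' : on_mordell c' (Some (u, v)).
  rewrite /= -subr_eq0; apply/eqP; apply: (place0_eq pr).
  rewrite -(subrr (y ^+ 2)) {2}(eqP oP); apply: (placeB pr); first exact: (placeM pr).
  by apply: (placeD pr) => //; do 2![apply: (placeM pr) => //].
pose P' : mordell_group sm' := Mordell oP'; exists F, c', sm', P', k.
have rel i : (i <= q)%N ->
    point_rel r (val (P *+ i : mordell c)) (val (P' *+ i : mordell c')).
  elim: i => // i IH iq; rewrite !mulrS !val_add eP.
  apply: (point_rel_add pr oP) => //; first exact: (valP (_ : mordell c)).
  - exact/IH/ltnW.
  - by apply: dom; rewrite !inE eqxx !orbT.
  - case eQ: (val (P *+ i : mordell c)) => [[x2 y2]|] //; apply: dom.
    rewrite mem_cat orbC; apply/orP; left; apply/mapP; exists i; last by rewrite eQ.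
    by rewrite mem_iota.
split=> //.
apply/eqP; rewrite val_eq0; have := rel q (leqnn q); rewrite Pq /=.
by case: (val _) => [[]|].
Qed.

Lemma prime_order_dvd_card (V : finZmodType) q (P : V) :
  prime q -> P *+ q = 0 -> P != 0 -> (q %| #|V|)%N.
Proof.
move=> pq Pq P0; have h : (#[P]%g %| q)%N by rewrite order_dvdn FinRing.zmodXgE Pq.
have : #[P]%g != 1%N by rewrite order_eq1.
by move/(prime_nt_dvdP pq)/(_ h) => <-; rewrite -cardsT order_dvdG ?inE.
Qed.

(** * Counting points over a finite field *)

Section Count.

Variables (F : finFieldType) (c : F).
Hypothesis F2mod3 : (#|F| %% 3 = 2)%N.

(** A quotient with cube 1 also satisfies [u ^ (#|F| - 1) = 1], and [#|F| - 1] is 1 modulo 3. *)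
Lemma cube_inj : injective (fun x : F => x ^+ 3).
Proof.
move=> x y /= e; case: (eqVneq y 0) => [y0|y0].
  by move/eqP: e; rewrite y0 expr0n /= expf_eq0 /= => /eqP.
have u3 : (x / y) ^+ 3 = 1 by rewrite expr_div_n e divff // expf_neq0.
have u0 : x / y != 0 by apply: contraTneq (oner_neq0 F) => u0; rewrite -u3 u0 expr0n eqxx.
have uF : (x / y) ^+ (#|F|.-1) = 1.
  apply: (mulfI u0); rewrite -exprS prednK ?mulr1; first exact: expf_card.
  by rewrite (cardD1 0).
have eF : #|F|.-1 = (3 * (#|F| %/ 3) + 1)%N.
  by rewrite {1}(divn_eq #|F| 3) F2mod3; lia.
move: uF; rewrite eF exprD exprM u3 expr1n mul1r expr1 => u1.
by rewrite -[x](divfK y0) u1 mul1r.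
Qed.

HB.instance Definition _ := [Finite of mordell c by <:].

(** Every ordinate [y] belongs to exactly one affine point, whose abscissa is the cube root of
    [y ^ 2 - c]. *)
Lemma card_mordell : #|{: mordell c}| = #|F|.+1.
Proof.
rewrite card_sub.
have [g gK Kg] := injF_bij cube_inj.
have -> : #|[pred P | on_mordell c P]| = #|None :: [seq Some (g (y ^+ 2 - c), y) | y : F]|.
  apply: eq_card => -[[x y]|]; rewrite !inE //=; apply/eqP/imageP => [e|[z _ [-> ->]]].
    by exists y => //; rewrite e addrK gK.
  by rewrite Kg subrK.
have /card_uniqP-> : uniq (None :: [seq Some (g (y ^+ 2 - c), y) | y : F]).
  rewrite /= map_inj_uniq ?enum_uniq ?andbT; last by move=> y z [].
  by apply/imageP => -[].
by rewrite /= size_image.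
Qed.

Lemma order_dvd_card_mordell (sm : smooth c) q (P : mordell_group sm) :
  prime q -> P *+ q = 0 -> P != 0 -> (q %| #|F|.+1)%N.
Proof.
move=> pq Pq P0; rewrite -card_mordell.
pose V : finZmodType := HB.pack (mordell_group sm) (Finite.on (mordell c)).
exact: (@prime_order_dvd_card V q P).
Qed.

End Count.

Lemma large_torsion_congruence (K : fieldExtType rat) (c : K) (sm : smooth c) q
    (P : mordell_group sm) :
  odd (\dim {:K}) -> prime q -> P *+ q = 0 -> P != 0 ->
  exists2 N : nat, (0 < N)%N & forall l, prime l -> ~~ (l %| N)%N -> (l %% 3 = 2)%N ->
  exists2 k, odd k & (q %| (l ^ k).+1)%N.
Proof.
move=> oK pq Pq P0; have [N N0 HN] := torsion_point_reduction oK Pq P0.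
exists N => // l pl lN l3; have [F [c' [sm' [P' [k [ok cF Pq' P0']]]]]] := HN l pl lN.
exists k => //; rewrite -cF; apply: order_dvd_card_mordell Pq' P0' => //.
rewrite cF -modnXm l3 -(odd_double_half k) ok -muln2 mulnC expnD expnM.
by rewrite -modnMmr -modnXm /= exp1n.
Qed.

(** * Norms of cyclotomic integers *)

Lemma card_Zp_annihilator m d : (1 < m)%N ->
  #|[set x : 'Z_m | x *+ d == 0]| = gcdn d m.
Proof.
move=> m1; have m0 : (0 < m)%N := ltnW m1.
have g0 : (0 < gcdn d m)%N by rewrite gcdn_gt0 m0 orbT.
set g := gcdn d m in g0 *.
have [k ek] : exists k, m = (g * k)%N by have /dvdnP[k ->] := dvdn_gcdr d m; exists k; rewrite mulnC.
have k0 : (0 < k)%N by move: m0; rewrite ek muln_gt0 => /andP[].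
pose h (i : 'I_g) : 'Z_m := (i * k)%:R.
have hlt (i : 'I_g) : (i * k < m)%N by rewrite ek ltn_pmul2r.
have hv (i : 'I_g) : h i = (i * k)%N :> nat by rewrite /h val_Zp_nat // modn_small.
have hinj : injective h.
  move=> i j /(congr1 (@nat_of_ord _)); rewrite !hv => /eqP; rewrite eqn_pmul2r // => /eqP e.
  exact: val_inj.
rewrite -[RHS]card_ord -cardsT -(card_imset _ hinj); congr #|pred_of_set _|.
have zE (x : nat) : (x%:R == 0 :> 'Z_m) = (m %| x)%N.
  apply/eqP/idP => [/(congr1 (@nat_of_ord _))|/dvdnP[j ->]]; rewrite ?natrM ?pchar_Zp ?mulr0 //.
  by rewrite val_Zp_nat // /dvdn => ->.
apply/setP => x; rewrite inE; apply/idP/imsetP => [|[i _ ->]].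
  rewrite -{1}[x]natr_Zp -mulrnA zE => hx.
  have /dvdnP[d' ed] := dvdn_gcdl d m; rewrite -/g in ed.
  have cop : coprime k d'.
    by rewrite coprime_sym /coprime -(eqn_pmul2r g0) mul1n muln_gcdl -ed mulnC -ek.
  have : (k %| x)%N.
    by rewrite -(Gauss_dvdl _ cop) -(@dvdn_pmul2l g) // -ek mulnCA [(g * d')%N]mulnC -ed.
  case/dvdnP=> i ei; have ig : (i < g)%N.
    have xm : (x < m)%N by have := ltn_ord x; rewrite [X in (_ < X)%N]Zp_cast.
    by move: xm; rewrite ei ek ltn_pmul2r.
  by exists (Ordinal ig) => //; apply: val_inj; rewrite [RHS]hv.
rewrite /h -mulrnA zE {1}ek; have /dvdnP[j ej] := dvdn_gcdl d m; rewrite -/g in ej.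
by rewrite ej mulnC -mulnA dvdn_mull // dvdn_mul // dvdn_mull.
Qed.

(** Smith normal form reduces this to a diagonal matrix; an entry [d] contributes its gcd with
    [l ^ e], which is its [l]-part because [e] bounds the valuation. *)
Lemma card_kernel_mod n (A : 'M[int]_n) l e :
  prime l -> (0 < e)%N -> \det A != 0 -> (logn l `|\det A| <= e)%N ->
  #|[set v : 'rV['Z_(l ^ e)]_n | v *m map_mx intr A == 0]| = (`|\det A|`_l)%N.
Proof.
move=> pl e0 dA le.
have m1 : (1 < l ^ e)%N by rewrite -(exp1n e) ltn_exp2r // prime_gt1.
have [L uL [R uR [d _ eA]]] := int_Smith_normal_form A.
set D := \matrix_(_, _) _ in eA.
have absu (U : 'M[int]_n) : U \in unitmx -> `|\det U|%N = 1%N.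
  by rewrite unitmxE => /orP[]/eqP->.
have eD : \det D = \prod_(i < n) d`_i.
  have -> : D = diag_mx (\row_(i < n) (d`_i)).
    by apply/matrixP => i j; rewrite !mxE.
  by rewrite det_diag; apply: eq_bigr => i _; rewrite mxE.
have edet : `|\det A|%N = (\prod_(i < n) `|(d`_i)%R|)%N.
  rewrite eA !det_mulmx !abszM (absu L) // (absu R) // mul1n muln1 eD.
  by elim/big_rec2: _ => // i x y _ <-; rewrite abszM.
pose f (U : 'M[int]_n) : 'M['Z_(l ^ e)]_n := map_mx intr U.
have fu (U : 'M[int]_n) : U \in unitmx -> f U \in unitmx.
  by rewrite !unitmxE /f det_map_mx; apply: rmorph_unit.
have inj : injective (fun v : 'rV_n => v *m f L).
  by move=> v w /(can_inj (mulmxK (fu L uL))).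
have -> : [set v : 'rV['Z_(l ^ e)]_n | v *m map_mx intr A == 0]
   = (fun v => v *m f L) @^-1: [set w | w *m f D == 0].
  apply/setP => v; rewrite !inE eA !map_mxM !mulmxA -/(f L) -/(f D) -/(f R).
  by rewrite -[RHS](inj_eq (can_inj (mulmxK (fu R uR)))) /= mul0mx.
rewrite card_preimset //.
have fD (w : 'rV_n) i : (w *m f D) 0 i = w 0 i * (d`_i)%:~R.
  rewrite mxE (bigD1 i) //= big1 ?addr0 => [|j ji]; rewrite !mxE; last first.
    by move: ji; rewrite -val_eqE /= => /negPf->; rewrite mulr0n rmorph0 mulr0.
  by rewrite eqxx mulr1n.
have absE (x : 'Z_(l ^ e)) (z : int) : (x *+ `|z|%N == 0) = (x * z%:~R == 0).
  rewrite -mulr_natr; case: (ger0P z) => hz.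
    by rewrite -[in RHS](gez0_abs hz).
  by rewrite -[z in RHS]opprK -(ltz0_abs hz) mulrNz mulrN oppr_eq0.
have d0 i : d`_(val (i : 'I_n)) != 0.
  apply: contraNneq dA => d0; rewrite -absz_eq0 edet.
  by rewrite (bigD1 i) //= d0 mul0n.
have -> : [set w | w *m f D == 0] = [set \row_i (h : {ffun 'I_n -> 'Z_(l ^ e)}) i |
    h in family (fun i : 'I_n => [set x : 'Z_(l ^ e) | x *+ `|(d`_i)%R|%N == 0])].
  apply/setP => w; rewrite inE; apply/eqP/imsetP => [hw|[h hf ->]].
    exists [ffun i => w 0 i]; last by apply/rowP => i; rewrite mxE ffunE.
    by apply/familyP => i; rewrite ffunE inE absE -fD hw mxE.
  apply/rowP => i; rewrite fD !mxE; apply/eqP; rewrite -absE.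
  by have /familyP/(_ i) := hf; rewrite inE.
rewrite card_imset; last first.
  by move=> h h' /rowP e'; apply/ffunP => i; have := e' i; rewrite !mxE.
rewrite card_family foldrE big_map big_enum /= edet.
have pE (J : seq 'I_n) : (\prod_(i <- J) #|[set x : 'Z_(l ^ e) | x *+ `|(d`_i)%R| == 0%R]|)%N
   = ((\prod_(i <- J) `|(d`_i)%R|)`_l)%N.
  elim: J => [|i J IH]; first by rewrite !big_nil partn1.
  rewrite !big_cons IH partnM ?absz_gt0 ?d0 //; last first.
    by apply: prodn_gt0 => j; rewrite absz_gt0 d0.
  congr (_ * _)%N; rewrite card_Zp_annihilator //.
  have le_i : (logn l `|(d`_i)%R| <= e)%N.
    apply: leq_trans le; apply: dvdn_leq_log; first by rewrite absz_gt0.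
    by rewrite edet (bigD1 i) //= dvdn_mulr.
  have : (0 < `|(d`_i)%R|)%N by rewrite absz_gt0 d0.
  move: (`|(d`_i)%R|%N) le_i => x le_x x0; rewrite -{1}(partnC l x0) p_part.
  rewrite gcdnC Gauss_gcdl; first by apply/gcdn_idPr; rewrite dvdn_exp2l.
  by apply: (@pnat_coprime l); rewrite ?part_pnat // pnatX pnat_id.
exact: pE.
Qed.

(* [C] acts on the l-part of the cokernel of [A] as an automorphism of order q
   without nonzero fixed points. *)
Lemma det_part_congruence n (A C : 'M[int]_n.+1) q l :
  prime q -> prime l -> l != q -> \det A != 0 -> A * C = C * A ->
  \sum_(i < q) C ^+ i = 0 -> ((`|\det A|`_l)%N = 1 %[mod q])%N.
Proof.
move=> pq pl lq dA AC C0.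
(* The successor keeps [l ^ e > 1] even if [l] does not divide the determinant, so that [R] is the
   ring of residues. *)
pose e := (logn l `|\det A|).+1; pose R := 'Z_(l ^ e).
have m1 : (1 < l ^ e)%N by rewrite -(exp1n e) ltn_exp2r // prime_gt1.
pose A' : 'M[R]_n.+1 := map_mx intr A; pose C' : 'M[R]_n.+1 := map_mx intr C.
have AC' : A' * C' = C' * A' by rewrite /A' /C' -!rmorphM AC.
have C'0 : \sum_(i < q) C' ^+ i = 0.
  have := congr1 (map_mx (intr : int -> R)) C0; rewrite raddf0 raddf_sum /= => {2}<-.
  by apply: eq_bigr => i _; rewrite rmorphXn.
have C'q : C' ^+ q = 1 by apply/eqP; rewrite -subr_eq0 subrX1 C'0 mulr0.
have injC : injective (fun v : 'rV[R]_n.+1 => v *m C').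
  apply: (can_inj (g := fun v => v *m C' ^+ q.-1)) => v.
  by rewrite -mulmxA mulmxE -exprS prednK ?prime_gt0 // C'q mulmx1.
pose t := perm injC.
have tX k v : (t ^+ k)%g v = v *m C' ^+ k.
  elim: k v => [|k IH] v; first by rewrite expg0 perm1 expr0 mulmx1.
  by rewrite expgS permM IH permE -mulmxA mulmxE -exprS.
have tq : (t ^+ q)%g = 1%g by apply/permP => v; rewrite tX C'q mulmx1 perm1.
have qG : (q.-group <[t]>)%g.
  by apply: (@pnat_dvd _ q); rewrite ?pnat_id // -orderE order_dvdn tq.
pose S : {set 'rV[R]_n.+1} := [set v | v *m A' == 0].
have acts : [acts <[t]>, on S | 'P]%g.
  rewrite cycle_subG; apply/astabsP => v.
  rewrite /= apermE permE !inE -mulmxA.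
  have -> : C' *m A' = A' *m C' by rewrite !mulmxE AC'.
  by rewrite -[RHS](inj_eq injC) /= mul0mx mulmxA.
have := pgroup_fix_mod qG acts; rewrite card_kernel_mod //.
(* Applying the vanishing sum of powers of [C] to a fixed [v] gives [q v = 0], and [q] is a unit
   modulo [l]. *)
have -> : ('Fix_(S | 'P)(<[t]>))%g = [set 0].
  apply/setP => v; rewrite in_setI in_set1; apply/andP/eqP => [[vS /afixP fx]|->].
    have vC : v *m C' = v by have := fx t (cycle_id t); rewrite /= apermE permE.
    have vX k : v *m C' ^+ k = v.
      by elim: k => [|k IH]; rewrite ?expr0 ?mulmx1 // exprS -mulmxE mulmxA vC.
    have : v *m (\sum_(i < q) C' ^+ i) = 0 by rewrite C'0 mulmx0.
    rewrite mulmx_sumr (eq_bigr (fun=> v)) => [|i _]; last exact: vX.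
    rewrite sumr_const card_ord => vq.
    have uq : (q%:R : R) \is a GRing.unit.
      by rewrite unitZpE // coprimeXl // prime_coprime // dvdn_prime2.
    by rewrite -[v]scale1r -(mulVr uq) -scalerA scaler_nat vq scaler0.
  split; first by rewrite inE mul0mx.
  by apply/afixP => a /cycleP[k ->]; rewrite /= apermE tX mul0mx.
by rewrite cards1.
Qed.

(* The companion matrix of [1 + X + ... + X^(n+1)]. *)
Definition cyclo_mx (R : comNzRingType) n : 'M[R]_n.+1 :=
  \matrix_(i, j) if i == ord_max then -1 else (i.+1 == j)%:R.

Lemma map_cyclo_mx (R S : comNzRingType) (f : {rmorphism R -> S}) n :
  map_mx f (cyclo_mx R n) = cyclo_mx S n.
Proof.
by apply/matrixP => i j; rewrite !mxE; case: ifP => _; rewrite ?rmorphN1 ?rmorph_nat.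
Qed.

(** The first basis vector is cyclic: its images under powers of [C] are the basis vectors, so it
    suffices to evaluate the sum on it. *)
Lemma sum_cyclo_mx (R : comNzRingType) n : \sum_(i < n.+2) cyclo_mx R n ^+ i = 0.
Proof.
set C := cyclo_mx R n; pose d (k : nat) : 'rV[R]_n.+1 := \row_j (k == j)%:R.
have dC k : (k < n)%N -> d k *m C = d k.+1.
  move=> kn; apply/rowP => j; rewrite !mxE (bigD1 (Ordinal (ltnW kn : (k < n.+1)%N))) //=.
  rewrite !mxE eqxx mul1r big1 ?addr0 => [|i ik].
    by rewrite -val_eqE /= ltn_eqF.
  by rewrite !mxE (_ : (k == i) = false) ?mul0r //; apply/negbTE; rewrite eq_sym -val_eqE in ik *.
have dX k : (k <= n)%N -> d 0%N *m C ^+ k = d k.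
  elim: k => [|k IH] kn; first by rewrite expr0 mulmx1.
  by rewrite exprSr -mulmxE mulmxA IH ?dC // ltnW.
have dn : d n *m C = const_mx (-1).
  apply/rowP => j; rewrite !mxE (bigD1 ord_max) //= !mxE !eqxx mul1r big1 ?addr0 // => i ik.
  by rewrite !mxE (_ : (n == i) = false) ?mul0r //; apply/negbTE; rewrite eq_sym -val_eqE in ik *.
have lo (k : 'I_n.+1) : (k <= n)%N by rewrite -ltnS.
have d0 : d 0%N *m (\sum_(i < n.+2) C ^+ i) = 0.
  rewrite mulmx_sumr big_ord_recr /= exprSr -mulmxE mulmxA dX // dn.
  apply/rowP => j; rewrite !mxE summxE (bigD1 j) //= dX ?lo // mxE eqxx.
  rewrite big1 ?addr0 ?subrr // => i ij; rewrite dX ?lo // mxE.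
  by rewrite val_eqE (negPf ij).
apply/row_matrixP => k; rewrite row0 rowE.
have -> : delta_mx 0 k = d k by apply/rowP => j; rewrite !mxE eqxx /= eq_sym val_eqE.
rewrite -dX ?lo // -mulmxA.
have -> : C ^+ k *m (\sum_(i < n.+2) C ^+ i) = (\sum_(i < n.+2) C ^+ i) *m C ^+ k.
  by rewrite mulmx_sumr mulmx_suml; apply: eq_bigr => i _; rewrite !mulmxE -!exprD addnC.
by rewrite mulmxA d0 mul0mx.
Qed.

(** The columns of the Vandermonde matrix are eigenvectors of the companion matrix, with eigenvalues
    [z j]. *)
Lemma det_horner_cyclo (L : fieldType) n (z : 'I_n.+1 -> L) (a : {poly L}) :
  injective z -> (forall j, \sum_(i < n.+2) z j ^+ i = 0) ->
  \det (horner_mx (cyclo_mx L n) a) = \prod_j a.[z j].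
Proof.
move=> zinj z0; set C := cyclo_mx L n.
pose zr := \row_j z j; pose V := Vandermonde n.+1 zr.
have dV : \det V != 0.
  rewrite det_Vandermonde; apply/prodf_neq0 => i _; apply/prodf_neq0 => j ij.
  by rewrite !mxE subr_eq0 (inj_eq zinj) -val_eqE gtn_eqF.
have CV : C *m V = V *m diag_mx zr.
  apply/matrixP => i j; rewrite mul_mx_diag !mxE.
  case: (eqVneq i ord_max) => [->|im].
    have := z0 j; rewrite big_ord_recr /= => /eqP; rewrite addrC addr_eq0 exprSr => /eqP->.
    by rewrite -sumrN; apply: eq_bigr => k _; rewrite !mxE eqxx mulN1r.
  have iN : (i < n)%N.
    by rewrite ltn_neqAle -ltnS ltn_ord andbT; move: im; rewrite -val_eqE.
  rewrite (bigD1 (Ordinal (iN : (i.+1 < n.+1)%N))) //= !mxE (negPf im) eqxx mul1r.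
  rewrite big1 ?addr0 ?exprSr // => k; rewrite -val_eqE /= eq_sym => ki.
  by rewrite !mxE (negPf im) (negPf ki) mul0r.
have aV (p : {poly L}) : horner_mx C p *m V = V *m diag_mx (\row_j p.[z j]).
  elim/poly_ind: p => [|p c IH].
    rewrite rmorph0 mul0mx; symmetry; apply/matrixP => i j.
    by rewrite mul_mx_diag !mxE horner0 mulr0.
  rewrite rmorphD rmorphM /= horner_mx_X horner_mx_C mulmxDl -mulmxE -mulmxA CV mulmxA IH.
  apply/matrixP => i j; rewrite mxE -mulmxA mulmx_diag !mul_mx_diag mul_scalar_mx !mxE.
  by rewrite !hornerE /=; ring.
apply: (mulIf dV); rewrite -det_mulmx aV det_mulmx det_diag mulrC; congr (_ * _).
by apply: eq_bigr => j _; rewrite mxE.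
Qed.

Lemma finField_prim_root (L : finFieldType) q :
  prime q -> (q %| #|L|.-1)%N -> exists z : L, q.-primitive_root z.
Proof.
move=> pq qL; have := qL; rewrite -card_finField_unit => /(Cauchy pq)[u _ ou].
have uq : (FinRing.uval u) ^+ q = 1.
  by rewrite -FinRing.val_unitX -ou expg_order.
have [m mq mz] := prim_order_exists (prime_gt0 pq) uq.
exists (FinRing.uval u); suff <- : m = q by [].
apply: prime_nt_dvdP => //; apply: contraTneq (prime_gt1 pq) => m1.
rewrite m1 in mq; have u1 : u = 1%g by apply: val_inj; exact: (prim_expr_order mq).
by rewrite -ou u1 order1.
Qed.

(** [X ^ h - 1] has at most [h] roots among the [2 * h] nonzero elements; elsewhere the [h]-th power
    is the other square root of 1. *)
Lemma finField_nonsquare (L : finFieldType) h : (#|L|.-1 = 2 * h)%N ->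
  exists2 g : L, g != 0 & g ^+ h = -1.
Proof.
move=> eL; have L1 : (0 < #|L|.-1)%N by rewrite -ltnS prednK ?finNzRing_gt1 // (ltn_trans _ (finNzRing_gt1 L)).
have h0 : (0 < h)%N by move: L1; rewrite eL muln_gt0.
have [g g0 gh] : exists2 g : L, g != 0 & g ^+ h != 1.
  apply: NNPP => no.
  have := @max_poly_roots L ('X^h - 1) (enum (predC1 (0 : L))).
  rewrite -size_poly_eq0 size_XnsubC // => /(_ isT).
  have -> : all (root ('X^h - 1)) (enum (predC1 (0 : L))).
    apply/allP => x; rewrite mem_enum !inE => x0.
    rewrite rootE !hornerE subr_eq0; apply/negPn/negP => xh; apply: no; by exists x.
  by rewrite enum_uniq -cardE cardC1 eL => /(_ isT isT); rewrite ltnS; lia.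
exists g => //; have : (g ^+ h - 1) * (g ^+ h + 1) = 0.
  rewrite -subr_sqr_1 -exprM mulnC -eL; apply/eqP; rewrite subr_eq0; apply/eqP.
  by apply: (mulfI g0); rewrite -exprS prednK ?mulr1 ?expf_card // (cardD1 0).
by move/eqP; rewrite mulf_eq0 subr_eq0 (negPf gh) /= addr_eq0 => /eqP.
Qed.

(** * A cyclotomic integer of norm congruent to -1 modulo 3 *)

Section Norm.

Variable n : nat.
Let q := n.+2.
Hypotheses (q_prime : prime q) (q3 : q != 3).

Let cop3 k : coprime (3 ^ k) q.
Proof. by rewrite coprimeXl // prime_coprime // dvdn_prime2 // eq_sym. Qed.

(** [f] is the multiplicative order of 3 modulo [q]. *)
Lemma order3_mod : exists2 f, (0 < f)%N & forall i j,
  (3 ^ i == 3 ^ j %[mod q]) = (i == j %[mod f]).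
Proof.
have ex : exists f, (0 < f)%N && (3 ^ f == 1 %[mod q]).
  exists (totient q); rewrite totient_gt0 /=.
  by rewrite Euler_exp_totient // -(expn1 3) cop3.
case: (ex_minnP ex) => f /andP[f0 /eqP ef] fmin; exists f => //.
have key r : (r < f)%N -> (3 ^ r == 1 %[mod q]) -> r = 0%N.
  by case: r => // r rf e; have := fmin r.+1 e; rewrite leqNgt rf.
have red k : 3 ^ k = 3 ^ (k %% f) %[mod q].
  rewrite {1}(divn_eq k f) addnC expnD [(k %/ f * f)%N]mulnC expnM.
  by rewrite -modnMmr -modnXm ef modnXm exp1n modnMmr muln1.
have one k : (3 ^ k == 1 %[mod q]) = (f %| k)%N.
  rewrite red; apply/idP/idP => [/key|/eqP->]; last by rewrite expn0.
  by rewrite ltn_pmod // /dvdn => /(_ isT)->.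
have half i j : (i <= j)%N -> (3 ^ j == 3 ^ i %[mod q]) = (j == i %[mod f]).
  move=> ij; rewrite !eqn_mod_dvd ?leq_exp2l // -one eqn_mod_dvd ?expn_gt0 //.
  have -> : (3 ^ j - 3 ^ i = 3 ^ i * (3 ^ (j - i) - 1))%N.
    by rewrite mulnBr muln1 -expnD subnKC.
  by rewrite Gauss_dvdr // coprime_sym.
move=> i j; case: (leqP i j) => [|/ltnW] ij; last exact: half.
by rewrite eq_sym half // eq_sym.
Qed.

(* [a] interpolates at the primitive q-th roots of unity [z ^ j] the function equal
   to [g ^ (3 ^ i)] if [j = 3 ^ i] and to 1 off the orbit of 1 under tripling. This
   function commutes with the Frobenius, so that [a] has coefficients in F_3, and
   its values multiply to [g ^ ((3 ^ f - 1) / 2) = -1], as [g] is not a square. *)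
Lemma norm_opp1 : exists a : {poly int},
  (3 %| (\det (horner_mx (cyclo_mx int n) a) + 1))%Z.
Proof.
have [f f0 fP] := order3_mod.
have [L ch3 cL] := PrimePowerField (isT : prime 3) f0.
have qL : (q %| #|L|.-1)%N.
  by rewrite cL -subn1 -eqn_mod_dvd ?expn_gt0 // -(expn0 3) fP modnn mod0n.
have [z zq] := finField_prim_root q_prime qL.
have sum3 : (#|L|.-1 = 2 * \sum_(i < f) 3 ^ i)%N by rewrite cL predn_exp.
have [g g0 gh] := finField_nonsquare sum3.
have gfrob : g ^+ (3 ^ f) = g by rewrite -cL expf_card.
have gper k i : g ^+ (3 ^ (k * f + i)) = g ^+ (3 ^ i).
  by elim: k => // k IH; rewrite mulSn -addnA expnD exprM gfrob.
have gP i j : (3 ^ i == 3 ^ j %[mod q]) -> g ^+ (3 ^ i) = g ^+ (3 ^ j).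
  rewrite fP => /eqP ij; rewrite (divn_eq i f) (divn_eq j f) !gper ij //.
pose y j := if [pick i : 'I_f | 3 ^ i == j %[mod q]] is Some i then g ^+ (3 ^ i) else 1.
have yP i j : (3 ^ i == j %[mod q]) -> y j = g ^+ (3 ^ i).
  move=> ij; rewrite /y; case: pickP => [k kj|/(_ (Ordinal (ltn_pmod i f0)))].
    by apply: gP; rewrite (eqP kj) eq_sym.
  have -> : (3 ^ (i %% f) == j %[mod q]) by rewrite -(eqP ij) fP modn_mod.
  by [].
have y1 j : (forall i, 3 ^ i != j %[mod q]) -> y j = 1.
  by move=> no; rewrite /y; case: pickP => // i; rewrite (negPf (no i)).
have yM j : y (3 * j)%N = y j ^+ 3.
  have [[i ij]|no] := classic (exists i, 3 ^ i == j %[mod q]).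
    have ij' : (3 ^ i.+1 == 3 * j %[mod q]) by rewrite expnS -modnMmr (eqP ij) modnMmr.
    by rewrite (yP _ _ ij) (yP _ _ ij') -exprM -expnSr.
  rewrite !y1 ?expr1n // => i; apply/negP => ij; apply: no; first by exists i.
  (* [3 ^ f.-1] inverts 3 modulo [q], so the orbit is closed under division by 3. *)
  exists (i + f.-1)%N.
  have : (3 ^ (i + f.-1) == (3 * j) * 3 ^ f.-1 %[mod q])%N.
    by rewrite expnD -modnMml (eqP ij) modnMml.
  rewrite mulnAC -expnS prednK // -[X in _ == X]modnMml.
  have /eqP-> : (3 ^ f == 1 %[mod q]) by rewrite -(expn0 3) fP modnn mod0n.
  by rewrite modnMml mul1n.
have yeq i j : i = j %[mod q] -> y i = y j.
  move=> ij; have [[k kj]|no] := classic (exists i, 3 ^ i == j %[mod q]).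
    by rewrite (yP _ _ kj) (yP k) // ij.
  rewrite !y1 // => k; apply/negP => kj; apply: no; first by exists k.
  by exists k; rewrite -ij.
pose zr : 'I_n.+1 -> L := fun j => z ^+ j.+1.
have zE i j : (z ^+ i == z ^+ j) = (i == j %[mod q]) := eq_prim_root_expr zq i j.
have jq (j : 'I_n.+1) : (j.+1 < q)%N := ltn_ord j.
have zinj : injective zr.
  by move=> i j /eqP; rewrite zE !modn_small // => /eqP[e]; exact: val_inj.
pose V := Vandermonde n.+1 (\row_j zr j).
have uV : V \in unitmx.
  rewrite unitmxE unitfE det_Vandermonde; apply/prodf_neq0 => i _.
  by apply/prodf_neq0 => j ij; rewrite !mxE subr_eq0 (inj_eq zinj) -val_eqE gtn_eqF.
(* Lagrange interpolation through the inverse Vandermonde matrix. *)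
pose co := (\row_(j < n.+1) y j.+1) *m invmx V.
pose a := \poly_(i < n.+1) co 0 (inord i).
have sa : (size a <= n.+1)%N by apply: size_poly.
have az (j : 'I_n.+1) : a.[z ^+ j.+1] = y j.+1.
  have /rowP/(_ j) : co *m V = \row_(j < n.+1) y j.+1 by rewrite mulmxKV.
  rewrite !mxE => <-; rewrite horner_poly; apply: eq_bigr => i _.
  by rewrite !mxE inord_val.
have azN j : ~~ (q %| j)%N -> a.[z ^+ j] = y j.
  move=> qj; have : (0 < j %% q < q)%N by rewrite lt0n ltn_pmod // andbT.
  case e : (j %% q)%N => [|i] // iq; have := az (Ordinal (iq : (i < n.+1)%N)).
  rewrite /= -e (yeq _ j) ?modn_mod // => <-; congr (_.[_]).
  by apply/eqP; rewrite zE modn_mod.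
pose a' := map_poly (pFrobenius_aut ch3) a.
have aa' : a = a'.
  (* The two polynomials have size at most [n.+1] and agree at the [n.+1] primitive roots. *)
  apply/eqP; rewrite -subr_eq0; apply/eqP.
  apply: (@roots_geq_poly_eq0 _ _ [seq zr j | j : 'I_n.+1]).
  - apply/allP => _ /imageP[j _ ->]; rewrite rootE !hornerE subr_eq0 az.
    have ej : (3 * (3 ^ f.-1 * j.+1) = j.+1 %[mod q])%N.
      rewrite mulnA -expnS prednK // -modnMml.
      have /eqP-> : (3 ^ f == 1 %[mod q]) by rewrite -(expn0 3) fP modnn mod0n.
      by rewrite modnMml mul1n.
    have -> : zr j = pFrobenius_aut ch3 (z ^+ (3 ^ f.-1 * j.+1)).
      by rewrite pFrobenius_autE -exprM mulnC; apply/eqP; rewrite zE ej.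
    rewrite horner_map azN /= ?pFrobenius_autE -?yM ?(yeq _ _ ej) //.
    rewrite Gauss_dvdr; last by rewrite coprime_sym.
    by rewrite gtnNdvd.
  - by rewrite map_inj_uniq ?enum_uniq.
  - rewrite size_image card_ord (leq_trans (size_polyD _ _)) // size_polyN geq_max sa.
    by rewrite size_map_poly.
have acube i : a`_i ^+ 3 = a`_i.
  by rewrite {2}aa' coef_map /= pFrobenius_autE.
(* Coefficients fixed by cubing lie in the prime field, whose elements are 0, 1 and -1. *)
pose lift (x : L) : int := if x == 0 then 0 else if x == 1 then 1 else -1.
have liftE (x : L) : x ^+ 3 = x -> (lift x)%:~R = x.
  move=> xx; rewrite /lift; case: eqVneq => [->//|x0]; case: eqVneq => [->//|x1].
  have : (x - 1) * (x + 1) = 0.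
    by apply: (mulfI x0); rewrite mulr0 -subr_sqr_1 mulrBr mulr1 -exprS xx subrr.
  by move/eqP; rewrite mulf_eq0 subr_eq0 (negPf x1) /= addr_eq0 => /eqP->.
pose A0 := \poly_(i < n.+1) lift a`_i; exists A0.
have eA0 : map_poly intr A0 = a.
  apply/polyP => i; rewrite coef_map /= coef_poly; case: ltnP => [_|ni].
    exact: liftE.
  by rewrite rmorph0 nth_default // (leq_trans sa).
rewrite (dvdz_pcharf ch3) rmorphD rmorph1 -det_map_mx map_horner_mx map_cyclo_mx eA0.
rewrite (det_horner_cyclo _ zinj) => [|j]; last first.
  have zj1 : zr j - 1 != 0 by rewrite subr_eq0 /zr -(expr0 z) zE mod0n modn_small.
  by apply: (mulfI zj1); rewrite mulr0 -subrX1 -exprM mulnC exprM (prim_expr_order zq) expr1n subrr.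
under eq_bigr => j _ do rewrite az.
have p3 i : (0 < 3 ^ i %% q)%N.
  rewrite lt0n; apply/negP => /eqP e; have := cop3 i.
  by rewrite /coprime -gcdn_modl e gcd0n.
have pn i : ((3 ^ i %% q).-1 < n.+1)%N by rewrite -ltnS prednK // ltn_pmod.
pose h (i : 'I_f) : 'I_n.+1 := Ordinal (pn i).
have hE i : (h i).+1 = (3 ^ i %% q)%N by rewrite /= prednK.
have hinj : injective h.
  move=> i j e; have : (3 ^ i == 3 ^ j %[mod q]) by rewrite -!hE e.
  by rewrite fP !modn_small // => /eqP/val_inj.
rewrite (bigID (mem (h @: setT))) /= [X in _ * X]big1 ?mulr1 => [|j jh]; last first.
  apply: y1 => i; apply: contra jh => ij; apply/imsetP.
  exists (Ordinal (ltn_pmod i f0)) => //; apply: val_inj => /=.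
  have : (3 ^ (i %% f) == 3 ^ i %[mod q]) by rewrite fP modn_mod.
  by move=> /eqP->; rewrite (eqP ij) modn_small.
rewrite big_imset /=; last by move=> i j _ _ /hinj.
rewrite (eq_bigr (fun i : 'I_f => g ^+ (3 ^ i))) => [|i _]; last first.
  by apply: yP; rewrite hE modn_mod.
rewrite -(big_morph _ (exprD g) (expr0 g)) (eq_bigl xpredT) => [|i]; last by rewrite inE.
by rewrite gh addNr.
Qed.

End Norm.

(** Horner's scheme: once [p.[s] >= 1], the value [p.[s] * s + c] is positive for [s > |c|]. Applied
    to a characteristic polynomial, this makes a norm positive. *)
Lemma monic_eventually_pos (p : {poly int}) : p \is monic ->
  exists S : nat, forall s : nat, (S <= s)%N -> 0 < p.[s%:Z].
Proof.
elim/poly_ind: p => [|p c IH]; first by rewrite monicE lead_coef0.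
move=> mp; case: (eqVneq p 0) => [p0|p0].
  exists 0%N => s _; move: mp; rewrite p0 mul0r add0r monicE lead_coefC => /eqP->.
  by rewrite hornerC.
have mp' : p \is monic.
  move: mp; rewrite !monicE lead_coefDl ?lead_coefMX // size_mulX //.
  by rewrite ltnS (leq_trans (size_polyC_leq1 _)) // size_poly_gt0.
have [S HS] := IH mp'; exists (maxn S `|c|.+1)%N => s; rewrite geq_max => /andP[sS sc].
rewrite !hornerE; have := HS s sS; move: (p.[s%:Z]) => v v0.
have h : s%:Z <= v * s%:Z by rewrite ler_peMl.
have : - (`|c|%N%:Z) <= c by lia.
rewrite /=; lia.
Qed.

(** Otherwise every prime power in the factorisation of [m], hence [m] itself, would be 0 or 1
    modulo 3. *)
Lemma prime_factor_2mod3 (m : nat) : (m %% 3 = 2)%N ->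
  exists l, [/\ prime l, (l %% 3 = 2)%N & odd (logn l m)].
Proof.
move=> m3; have m0 : (0 < m)%N by case: m m3.
apply: NNPP => no; have : (m %% 3 = 0 \/ m %% 3 = 1)%N; last by rewrite m3; case.
rewrite {1 2}(prod_prime_decomp m0) prime_decompE big_map /=.
elim/big_rec: _ => [|l x _ IH]; first by right.
rewrite -modnMm; set u := (l ^ _ %% 3)%N.
have [u2|u2] : (u = 2)%N \/ (u = 0 \/ u = 1)%N.
- by have := ltn_pmod (l ^ logn l m) (isT : 0 < 3)%N; rewrite -/u; lia.
- exfalso; apply: no; exists l.
  have lv : (0 < logn l m)%N by rewrite lt0n; apply/eqP => e; move: u2; rewrite /u e.
  have pl : prime l by move: lv; rewrite logn_gt0 mem_primes => /andP[].
  move: u2; rewrite /u -modnXm; have := ltn_pmod l (isT : 0 < 3)%N.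
  case: (l %% 3)%N => [|[|[|]]] // _; rewrite ?exp0n ?exp1n //.
  case: (boolP (odd (logn l m))) => [//|ov]; rewrite -(odd_double_half (logn l m)) (negPf ov).
  by rewrite add0n -muln2 mulnC expnM -modnXm /= exp1n.
have {u2} : (u = 0 \/ u = 1)%N by [].
by move: IH; rewrite -/u; case=> -> [] ->; [left|left|left|right].
Qed.

Lemma horner_char_poly (R : comNzRingType) n (A : 'M[R]_n) x :
  (char_poly A).[x] = \det (x%:M - A).
Proof.
rewrite -[LHS]/(horner_eval x _) -det_map_mx; congr (\det _).
apply/matrixP => i j; rewrite !mxE /= /horner_eval !hornerE.
by rewrite hornerMn hornerX.
Qed.

(* [l] and [j] come from the factorisation of the norm [D] of [P], where [P] is
   congruent to 1 modulo every prime dividing [N q] other than 3, to [a0] modulo 3, and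
   is large enough for [D] to be positive. *)
Lemma prime_2mod3_odd_order q N : prime q -> (5 <= q)%N -> (0 < N)%N ->
  exists l j, [/\ prime l, ~~ (l %| N)%N, (l %% 3 = 2)%N, odd j
                & (l ^ j = 1 %[mod q])%N].
Proof.
case: q => [|[|n]] // pq q5 N0; have q3 : n.+2 != 3%N by apply: contraTneq q5 => ->.
have [a0 Ha0] := norm_opp1 pq q3.
have [M0 cM0 eN] := pfactor_coprime (isT : prime 3) N0.
pose M := (M0 * n.+2)%N.
have cM : coprime 3 M by rewrite coprimeMr cM0 prime_coprime // dvdn_prime2 // eq_sym.
have M_gt0 : (0 < M)%N by rewrite lt0n; apply: contraTneq cM => ->.
set C := cyclo_mx int n.
(* [M ^ 2] is 1 modulo 3 and 0 modulo the primes dividing [M]. *)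
pose B : {poly int} := 1 + (M ^ 2)%:R * (a0 - 1).
have [S HS] := monic_eventually_pos (char_poly_monic (- horner_mx C B)).
(* Shifting by a multiple of [3 * M] keeps the congruences and makes [D] a value of the
   characteristic polynomial of [- B(C)] far to the right. *)
pose P := B + (3 * M * S)%:R; set D := \det (horner_mx C P).
have D0 : 0 < D.
  have -> : D = (char_poly (- horner_mx C B)).[(3 * M * S)%:Z]; last first.
    by apply: HS; rewrite leq_pmull // muln_gt0.
  rewrite horner_char_poly opprK /D /P rmorphD rmorph_nat addrC; congr (\det (_ + _)).
  by rewrite -natz rmorph_nat.
have nat0 l k : prime l -> (l %| k)%N -> (k%:R : {poly 'F_l}) = 0.
  move=> pl lk; rewrite -polyC_natr; apply/eqP; rewrite polyC_eq0.
  by rewrite -(dvdn_pcharf (pchar_Fp pl)).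
have Dmod l : D%:~R = \det (horner_mx (cyclo_mx 'F_l n)
    (1 + (M ^ 2)%:R * (map_poly intr a0 - 1) + (3 * M * S)%:R)) :> 'F_l.
  rewrite -det_map_mx map_horner_mx map_cyclo_mx; congr (\det (horner_mx _ _)).
  rewrite /P /B; move: (M ^ 2)%N (3 * M * S)%N => k1 k2.
  by rewrite !rmorphD rmorphM rmorphB !rmorph_nat rmorph1.
have pr3 : prime 3 by [].
have D3 : (`|D| %% 3 = 2)%N.
  have : (3 %| D + 1)%Z.
    rewrite (dvdz_pcharf (pchar_Fp pr3)).
    move: Ha0; rewrite (dvdz_pcharf (pchar_Fp pr3)).
    rewrite !intrD Dmod -[X in X + _ == _ -> _]det_map_mx map_horner_mx map_cyclo_mx.
    rewrite (nat0 3 (3 * M * S)%N) ?addr0 //; last by rewrite -mulnA dvdn_mulr.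
    suff -> : ((M ^ 2)%:R : {poly 'F_3}) = 1 by rewrite mul1r [1 + (_ - _)]addrC subrK.
    apply/eqP; rewrite -subr_eq0 -(natrB _ (_ : 1 <= M ^ 2)%N) ?expn_gt0 ?M_gt0 //.
    rewrite nat0 // -eqn_mod_dvd ?expn_gt0 ?M_gt0 //.
    move: cM; rewrite prime_coprime // /dvdn -modnXm; have := ltn_pmod M (isT : 0 < 3)%N.
    by case: (M %% 3)%N => [|[|[|]]].
  by rewrite -(gtz0_abs D0) /dvdz; lia.
have [l [pl l3 ol]] := prime_factor_2mod3 D3.
have lD : (l %| `|D|)%N.
  by move: ol; case: (posnP (logn l `|D|)) => [->//|]; rewrite logn_gt0 mem_primes => /and3P[].
have lM : ~~ (l %| M)%N.
  apply: contraL lD => lM; rewrite -[(_ %| _)%N]/(l %| D)%Z (dvdz_pcharf (pchar_Fp pl)).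
  rewrite Dmod !nat0 ?dvdn_exp // ?mul0r ?addr0; last by rewrite mulnAC dvdn_mull.
  by rewrite rmorph1 det1 oner_eq0.
exists l, (logn l `|D|); split=> //.
  apply: contra lM => lN; rewrite dvdn_mulr //; move: lN; rewrite eN Euclid_dvdM //.
  by rewrite Euclid_dvdX // => /orP[//|/andP[]]; rewrite dvdn_prime2 // => /eqP l3'; rewrite l3' in l3.
have lq : l != n.+2 by apply: contraNneq lM => ->; rewrite dvdn_mull.
rewrite -p_part; apply: (det_part_congruence (C := C)) => //.
- by rewrite gt_eqF.
- by have := congr1 (horner_mx C) (mulrC P 'X); rewrite !rmorphM /= horner_mx_X.
- exact: sum_cyclo_mx.
Qed.

(** With [l ^ j = 1], [l ^ k = -1] modulo [q] and [j] odd, the power [l ^ (j * k)] is both 1 and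
    -1. *)
Lemma odd_congruences_absurd q N : prime q -> (5 <= q)%N -> (0 < N)%N ->
  (forall l, prime l -> ~~ (l %| N)%N -> (l %% 3 = 2)%N ->
    exists2 k, odd k & (q %| (l ^ k).+1)%N) -> False.
Proof.
move=> pq q5 N0 H; have [l [j [pl lN l3 oj lj]]] := prime_2mod3_odd_order pq q5 N0.
have [k ok qk] := H l pl lN l3.
have cq := pchar_Fp pq; pose x : 'F_q := l%:R.
have xj : x ^+ j = 1 by rewrite -natrX -(Fp_nat_mod pq) lj Fp_nat_mod.
have xk : x ^+ k = -1.
  by apply/eqP; rewrite -addr_eq0 -natrX natr1 -(dvdn_pcharf cq).
have : x ^+ (j * k) = x ^+ (k * j) by rewrite mulnC.
rewrite !exprM xj xk expr1n -signr_odd oj expr1 => /eqP.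
rewrite -addr_eq0 -(natrD _ 1 1) -(dvdn_pcharf cq) => /dvdn_leq; lia.
Qed.

(** * Torsion over fields of degree 3 p *)

Lemma rat_smooth (K : fieldExtType rat) (c : rat) : c != 0 -> smooth (c%:A : K).
Proof.
move=> c0; rewrite /smooth !natrK_neq0 scaler_eq0 oner_eq0 orbF.
exact: c0.
Qed.

Lemma torsion_structure (K : fieldExtType rat) p (c : rat) (sm : smooth (c%:A : K)) :
  prime p -> (5 <= p)%N -> \dim {:K} = (3 * p)%N ->
  exists2 m, m \in [:: 1; 2; 3; 6; 9]%N &
  exists2 g : mordell_group sm, order_is g m &
    forall P : mordell_group sm, (exists2 n, (0 < n)%N & P *+ n = 0) ->
      exists k, P = g *+ k.
Proof.
move=> pp p5 dK; apply: torsion_generator.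
- move=> q pq q5 P Pq; apply/eqP/negPn/negP => P0.
  have oK : odd (\dim {:K}) by rewrite dK odd_mul3_prime.
  have [N N0 HN] := large_torsion_congruence oK pq Pq P0.
  exact: (odd_congruences_absurd pq q5 N0 HN).
- exact: (order2_uniq pp p5 dK).
- exact: (no_point_order4 pp p5 dK).
- exact: (order3_uniq pp p5 dK).
- exact: (no_point_order27 pp p5 dK).
- exact: (no_point_order18 pp p5 dK).
Qed.

Lemma torsion_isom_cyclic (F : fieldType) (c : F) (sm : smooth c) m (g : mordell_group sm) :
  (0 < m)%N -> order_is g m ->
  (forall P : mordell_group sm, (exists2 n, (0 < n)%N & P *+ n = 0) -> exists k, P = g *+ k) ->
  torsion_isom c (cyclic_group m).
Proof.
case: m => // m _ gm gen.
have gmod k : g *+ (k %% m.+1) = g *+ k.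
  by rewrite [in RHS](divn_eq k m.+1) mulrnDr mulnC mulrnA gm.1 mul0rn add0r.
exists (fun i : 'I_m.+1 => g *+ i : mordell c); split.
- move=> i j /eqP; wlog ij : i j / (i <= j)%N.
    by move=> h; case: (leqP i j) => [/h//|/ltnW/h h' /eqP/esym/eqP/h' ->].
  rewrite -{1}(subnKC ij) mulrnDr => /eqP e.
  have {}e : g *+ (j - i) = 0 by rewrite -[LHS](addKr (g *+ i)) -e addNr.
  apply/val_inj/eqP; rewrite eqn_leq ij /= -subn_eq0; apply/negPn/negP => d0.
  have := gm.2 (j - i)%N; rewrite e eqxx lt0n d0 (leq_ltn_trans (leq_subr _ _)) //.
  by move=> /(_ isT).
- by move=> i j; rewrite [LHS]gmod [LHS]mulrnDr.
- move=> P; split=> [[n n0 Pn]|[i <-]]; last first.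
    by exists m.+1 => //; rewrite [LHS](mordell_mulE m.+1 (g *+ i)) -mulrnA mulnC mulrnA gm.1 mul0rn.
  have [|k ->] := gen P; first by exists n; rewrite // -mordell_mulE.
  by exists (Ordinal (ltn_pmod k (ltn0Sn m))); rewrite [LHS]gmod.
Qed.

Lemma torsion_isom_unique (F : fieldType) (c : F) (G H : zmodType) :
  torsion_isom c G -> torsion_isom c H -> isomorphic G H.
Proof.
move=> [f [finj fD fT]] [f' [f'inj f'D f'T]].
have exH g : exists h, f' h == f g.
  have /f'T[h eh] : is_torsion (f g) by apply/fT; exists g.
  by exists h; rewrite eh.
have exG h : exists g, f g == f' h.
  have /fT[g eg] : is_torsion (f' h) by apply/f'T; exists h.
  by exists g; rewrite eg.
pose u g : H := xchoose (exH g); pose v h : G := xchoose (exG h).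
have uE g : f' (u g) = f g := eqP (xchooseP (exH g)).
have vE h : f (v h) = f' h := eqP (xchooseP (exG h)).
have uD : {morph u : a b / a + b}.
  by move=> a b; apply: f'inj; rewrite f'D !uE fD.
have u0 : u 0 = 0 by apply: (addrI (u 0)); rewrite -uD !addr0.
have uB : zmod_morphism u.
  move=> a b; apply: (addIr (u b)); rewrite -uD !subrK //.
pose U : {additive G -> H} := HB.pack u (GRing.isZmodMorphism.Build G H u uB).
exists U; exists v => x /=; first by apply: finj; rewrite vE uE.
by apply: f'inj; rewrite uE vE.
Qed.

Lemma torsion_isom_transfer (F : fieldType) (c : F) (G H : zmodType) :
  isomorphic G H -> torsion_isom c H -> torsion_isom c G.
Proof.
move=> [u [v uK vK]] [f [finj fD fT]]; exists (f \o u); split=> [||P].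
- exact: inj_comp finj (can_inj uK).
- by move=> g h /=; rewrite raddfD fD.
- rewrite fT; split=> -[h <-]; first by exists (v h); rewrite /= vK.
  by exists (u h).
Qed.

(** * A field of degree 3 p containing the cubic field *)

Lemma irreducible_Xn_sub2 p : (1 < p)%N -> irreducible_poly ('X^p - 2%:R%:P : {poly rat}).
Proof.
move=> p1; have p0 := ltnW p1; pose q : {poly int} := 'X^p - 2%:R%:P.
have -> : 'X^p - 2%:R%:P = map_poly intr q :> {poly rat}.
  by rewrite /q rmorphB /= map_polyXn map_polyC.
have sq : size q = p.+1 by rewrite size_XnsubC.
apply/irreducible_rat_int; apply: (@eisenstein_crit 2) => //.
- by rewrite sq; case: (p) p1.
- by rewrite lead_coefXnsubC.
- by rewrite coefB coefXn coefC (ltn_eqF p0).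
- move=> i; rewrite sq /= => ip; rewrite coefB coefXn coefC ltn_eqF // sub0r.
  by case: eqP => _; rewrite ?oppr0 ?dvdz0.
Qed.

Lemma degree_3p_field p : prime p -> (5 <= p)%N ->
  exists (K : fieldExtType rat) (w : K),
    \dim {:K} = (3 * p)%N /\ w ^+ 3 = w ^+ 2 *+ 3 - 1.
Proof.
move=> pp p5; have p0 := prime_gt0 pp.
have [w0 hw0] : exists w0 : algC, w0 ^+ 3 = w0 ^+ 2 *+ 3 - 1.
  pose q : {poly algC} := 'X^3 + (- 3%:R *: 'X^2 + 1%:P).
  have sq : size q = 4%N.
    rewrite size_polyDl size_polyXn // (leq_ltn_trans (size_polyD _ _)) // gtn_max.
    by rewrite (leq_ltn_trans (size_scale_leq _ _)) ?size_polyXn // size_polyC oner_neq0.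
  have [|x] := @closed_rootP _ q _; first by rewrite sq.
  rewrite rootE !hornerE /= => /eqP e; exists x.
  by apply/eqP; rewrite -subr_eq0 -[X in _ == X]e; apply/eqP; ring.
have [K [f [s es gens]]] := num_field_exists [:: w0; p.-root 2%:R].
case: s es gens => [|w [|b [|]]] //= -[fw fb] gens; exists K, w.
have hw : w ^+ 3 = w ^+ 2 *+ 3 - 1.
  by apply: (fmorph_inj f); rewrite rmorphXn rmorphB rmorphMn rmorphXn rmorph1 fw hw0.
have hb : b ^+ p = 2%:R by apply: (fmorph_inj f); rewrite rmorphXn fb rootCK // rmorph_nat.
split=> //; apply/eqP; rewrite eqn_leq.
(* The tower over the cubic field bounds the degree above; the coprime degrees 3 and [p] of two
   subfields divide it. *)
apply/andP; split.
  have -> : {:K}%VS = <<<<1; w>>; b>>%VS by rewrite -gens !adjoin_cons Fadjoin_nil.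
  rewrite dim_Fadjoin (dim_cubic_field hw : \dim <<1; w>> = 3%N) mulnC leq_mul2l /=.
  rewrite -ltnS -size_minPoly -(size_XnsubC (2%:R : K) p0) dvdp_leq //.
    by rewrite -size_poly_eq0 size_XnsubC.
  rewrite minPoly_dvdp //; last by rewrite rootE !hornerE hb subrr.
  by rewrite rpredB ?rpredX ?polyOverX ?polyOverC ?rpred_nat.
apply: dvdn_leq; first exact: (adim_gt0 {:K}%AS).
rewrite Gauss_dvd; last by rewrite prime_coprime // dvdn_prime2 // ltn_eqF // (leq_trans _ p5).
have := field_dimS (subvf (cubic_field w)); rewrite dim_cubic_field // => -> /=.
have := field_dimS (subvf <<1; b>>%AS).
rewrite (dim_adjoin_root (irreducible_Xn_sub2 (prime_gt1 pp))) ?size_XnsubC //.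
by rewrite rmorphB /= map_polyXn map_polyC /= rootE !hornerE /= hb -in_algE rmorph_nat subrr.
Qed.

Lemma order_is_prime_dvd (V : zmodType) (g : V) m r k : order_is g m -> (0 < m)%N ->
  prime r -> g *+ k *+ r = 0 -> g *+ k != 0 -> (r %| m)%N.
Proof.
move=> gm m0 pr; rewrite -mulrnA => /(order_is_dvd gm m0) mk k0.
apply: contraNT k0; rewrite -prime_coprime // coprime_sym => cop.
by move: mk; rewrite Gauss_dvdl // => /dvdnP[j ->]; rewrite mulnC mulrnA gm.1 mul0rn.
Qed.

Lemma order_is_prime_exists (V : zmodType) (g : V) m r : order_is g m -> (0 < m)%N ->
  prime r -> (r %| m)%N -> exists2 P : V, P *+ r = 0 & P != 0.
Proof.
move=> gm m0 pr /dvdnP[j ej]; exists (g *+ j); first by rewrite -mulrnA -ej gm.1.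
have j0 : (0 < j)%N by move: m0; rewrite ej muln_gt0 => /andP[].
by apply: gm.2; rewrite j0 ej ltn_Pmulr // prime_gt1.
Qed.

(** * Recognising the torsion group *)

Section ExactTorsion.

Variables (K : fieldExtType rat) (p : nat).
Hypotheses (p_prime : prime p) (p_ge5 : (5 <= p)%N) (dimK : \dim {:K} = (3 * p)%N).

(** Divisibility by 2 and by 3 separates the five candidates except 3 from 9, hence the form of the
    last condition. *)
Lemma torsion_isom_of_orders (c : rat) (sm : smooth (c%:A : K)) m :
  m \in [:: 1; 2; 3; 6; 9]%N ->
  (if (2 %| m)%N then exists P : mordell_group sm, P *+ 2 = 0 /\ P != 0
   else forall P : mordell_group sm, P *+ 2 = 0 -> P = 0) ->
  (if (3 %| m)%N then exists P : mordell_group sm, P *+ 3 = 0 /\ P != 0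
   else forall P : mordell_group sm, P *+ 3 = 0 -> P = 0) ->
  (if (9 %| m)%N then exists P : mordell_group sm, P *+ 9 = 0 /\ P *+ 3 != 0
   else m = 3%N -> forall P : mordell_group sm, P *+ 9 = 0 -> P *+ 3 = 0) ->
  torsion_isom (c%:A : K) (cyclic_group m).
Proof.
move=> hm h2 h3 h9; have [m' hm' [g gm gen]] := torsion_structure sm p_prime p_ge5 dimK.
have m'0 : (0 < m')%N by move: hm'; rewrite !inE => /or4P[/eqP->|/eqP->|/eqP->|/orP[]/eqP->].
suff <- : m' = m by apply: torsion_isom_cyclic gen.
have fin r (P : mordell_group sm) : (0 < r)%N -> P *+ r = 0 -> exists k, P = g *+ k.
  by move=> r0 Pr; apply: gen; exists r.
have e2 : (2 %| m')%N = (2 %| m)%N.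
  case: ifP h2 => [_ [P [P2 P0]]|_ no].
    have [k ek] := fin 2%N P isT P2; rewrite ek in P2 P0.
    exact: order_is_prime_dvd gm m'0 _ P2 P0.
  by apply/negP => /(@order_is_prime_exists _ _ _ 2 gm m'0 isT)[P P2]; rewrite (no P P2) eqxx.
have e3 : (3 %| m')%N = (3 %| m)%N.
  case: ifP h3 => [_ [P [P3 P0]]|_ no].
    have [k ek] := fin 3%N P isT P3; rewrite ek in P3 P0.
    exact: order_is_prime_dvd gm m'0 _ P3 P0.
  by apply/negP => /(@order_is_prime_exists _ _ _ 3 gm m'0 isT)[P P3]; rewrite (no P P3) eqxx.
have e9 : (9 %| m)%N -> m' = 9%N.
  move=> m9; rewrite m9 in h9; have [P [P9 P3]] := h9.
  have [k ek] := fin 9%N P isT P9; rewrite ek -!mulrnA in P9 P3.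
  have d9 := order_is_dvd gm m'0 P9.
  have d3 : ~~ (m' %| k * 3)%N.
    by apply: contra P3 => /dvdnP[j ->]; rewrite mulnC mulrnA gm.1 mul0rn.
  by move: hm' d9 d3; rewrite !inE => /or4P[/eqP->|/eqP->|/eqP->|/orP[]/eqP->] //; lia.
have e9' : m' = 9%N -> m <> 3%N.
  move=> m'9 m3; rewrite m3 /= in h9; have := gm.2 3%N; rewrite m'9 h9 ?eqxx //.
    by move=> /(_ isT).
  by rewrite -m'9 gm.1.
move: hm hm' e2 e3 e9 e9'; rewrite !inE.
by case/or4P=> [/eqP->|/eqP->|/eqP->|/orP[]/eqP->];
  case/or4P=> [/eqP->|/eqP->|/eqP->|/orP[]/eqP->] // f2 f3 f9 f9';
  first [discriminate f2 | discriminate f3 | exact: f9 | by have := f9' erefl].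
Qed.

End ExactTorsion.

(** * Curves realising the five groups *)

Section Instances.

Variables (K : fieldExtType rat) (p : nat) (w : K).
Hypotheses (p_prime : prime p) (p_ge5 : (5 <= p)%N) (dimK : \dim {:K} = (3 * p)%N).
Hypothesis w_root : w ^+ 3 = w ^+ 2 *+ 3 - 1.

Let oddK : odd (\dim {:K}). Proof. by rewrite dimK odd_mul3_prime. Qed.

Let cube_ratN (x : K) (k : rat) : x ^+ 3 = k%:A -> exists q : rat, q ^+ 3 = k.
Proof.
move=> xk; have [q eq] := cube_rat w_root p_prime p_ge5 dimK xk; exists q.
by apply: (fmorph_inj (in_alg K)); rewrite rmorphXn /= -eq.
Qed.

Section Curve.

Variables (c : rat) (sm : smooth (c%:A : K)).

Lemma no_order2 : (forall q : rat, q ^+ 3 != - c) ->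
  forall P : mordell_group sm, P *+ 2 = 0 -> P = 0.
Proof.
move=> h P P2; apply/eqP/negPn/negP => P0; have [x _ hx] := order2_point P2 P0.
have [|q /eqP] := @cube_ratN x (- c); first by rewrite scaleNr.
exact/negP/h.
Qed.

Lemma no_order3 : (forall q : rat, q ^+ 2 != c) -> (forall q : rat, q ^+ 2 != - (c *+ 3)) ->
  forall P : mordell_group sm, P *+ 3 = 0 -> P = 0.
Proof.
move=> h h' P P3; apply/eqP/negPn/negP => P0; have [x [y [_ hy hx]]] := order3_point P3 P0.
case: hx => hx.
  have [|q /eqP] := @sqrt_rat_square K y c oddK; last exact/negP/h.
  by rewrite hy hx expr0n add0r.
have [|q /eqP] := @sqrt_rat_square K y (- (c *+ 3)) oddK; last exact/negP/h'.
by rewrite hy hx -!in_algE rmorphN rmorphMn; ring.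
Qed.

Lemma no_order9 : (forall q : rat, q ^+ 3 != c *+ 4) ->
  forall P : mordell_group sm, P *+ 9 = 0 -> P *+ 3 = 0.
Proof.
move=> h P P9; apply/eqP/negPn/negP => P3.
have [_ [v [_ [_ hv _ _]]]] := order9_point p_prime p_ge5 dimK P9 P3.
have [|q /eqP] := @cube_ratN v (c *+ 4); first by rewrite hv -scalerMnl.
exact/negP/h.
Qed.

Lemma has_order2 (t : rat) : t ^+ 3 = - c ->
  exists P : mordell_group sm, P *+ 2 = 0 /\ P != 0.
Proof.
move=> ht; have oP : on_mordell (c%:A : K) (Some (t%:A, 0)).
  rewrite /= expr0n eq_sym addr_eq0 -!in_algE -rmorphXn ht rmorphN //.
exists (Mordell oP); split=> //; apply/eqP; rewrite (@order2_coords _ _ sm _ t%:A 0) //.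
Qed.

(** [(0, d)] is a flex with horizontal tangent, so its double is its opposite. *)
Lemma has_order3 (d : rat) : d ^+ 2 = c ->
  exists P : mordell_group sm, P *+ 3 = 0 /\ P != 0.
Proof.
move=> hd; have [/and3P[K2 _ c0]] := sm.
have oP : on_mordell (c%:A : K) (Some (0, d%:A)).
  by rewrite /= expr0n add0r -!in_algE -rmorphXn hd.
pose P : mordell_group sm := Mordell oP; exists P; split=> //.
have d0 : (d%:A : K) != 0.
  by apply: contraNneq c0 => d0; rewrite -hd -in_algE rmorphXn /= d0 expr0n.
apply/eqP; rewrite mulrSr addr_eq0; apply/eqP/val_inj.
rewrite [LHS](double_coords (erefl : val (P : mordell _) = Some (0, d%:A)) d0) [RHS]val_oppr /=.
congr (Some (_, _)); rewrite expr0n /= mul0rn mul0r ?expr0n /=; ring.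
Qed.

End Curve.

(** As [4 * 16 = 4 ^ 3], [order9_point] suggests the abscissa [4 * w], and [64 * w ^ 3 + 16] is a
    square in the cubic field. The triple of this point is [(0, 4)], of order 3. *)
Lemma has_order9 (sm : smooth (16%:R%:A : K)) :
  exists P : mordell_group sm, P *+ 9 = 0 /\ P *+ 3 != 0.
Proof.
have K2 : (2%:R : K) != 0 by case/and3P: sm.
have e16 : (16%:R%:A : K) = 16%:R by rewrite -in_algE rmorph_nat.
pose x : K := w *+ 4; pose y : K := w ^+ 2 *+ 8 - w *+ 8 - 4%:R.
have oR : on_mordell (16%:R%:A : K) (Some (x, y)).
  by rewrite /= e16 /x /y; apply/eqP; ring: w_root.
pose R : mordell_group sm := Mordell oR.
have y0 : y != 0.
  (* The cofactor is [12 / y] in the basis of powers of [w]; the same device serves for [x2 - x]. *)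
  have e : y * (w ^+ 2 *+ 2 - w *+ 6 + 1) = 12%:R by rewrite /y; ring: w_root.
  by apply: contraTneq (natrK_neq0 K 11) => y0; rewrite -e y0 mul0r eqxx.
pose x2 : K := w ^+ 2 *+ 4 - w *+ 12 + 4%:R.
pose y2 : K := w *+ 32 - w ^+ 2 *+ 8 - 20%:R.
have nx : x2 - x != 0.
  have e : (x2 - x) * (w ^+ 2 - w *+ 3 - 1) = 12%:R by rewrite /x /x2; ring: w_root.
  by apply: contraTneq (natrK_neq0 K 11) => n0; rewrite -e n0 mul0r eqxx.
have e2 : val (R *+ 2 : mordell _) = Some (x2, y2).
  rewrite [LHS](double_coords (erefl : val (R : mordell _) = Some (x, y)) y0) /tangent_sum.
  have -> : x ^+ 2 *+ 3 / (y *+ 2) = w ^+ 2 *+ 2 - w *+ 4.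
    apply: (mulIf (dbl_neq0 K2 y0)); rewrite (divfK (dbl_neq0 K2 y0)).
    by rewrite /x /y; ring: w_root.
  by congr (Some (_, _)); rewrite /x /x2 /y /y2; ring: w_root.
have e3 : val (R *+ 3 : mordell _) = Some (0, 4%:R).
  rewrite [R *+ 3]mulrS val_add e2 raw_add_chord // /chord_sum.
  have -> : (y2 - y) / (x2 - x) = w *+ 2 - 2%:R.
    by apply: (mulIf nx); rewrite (divfK nx) /x /y /x2 /y2; ring: w_root.
  by congr (Some (_, _)); rewrite /x /x2 /y /y2; ring: w_root.
exists R; split; last by rewrite val_eq0 e3.
have n4 : (4%:R : K) != 0 := natrK_neq0 K 3.
rewrite -[9%N]/(3 * 3)%N [R *+ _]mulrnA; apply/eqP.
rewrite [R *+ 3 *+ 3]mulrSr addr_eq0; apply/eqP/val_inj.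
rewrite [LHS](double_coords e3 n4) [RHS]val_oppr e3 /=.
congr (Some (_, _)); rewrite expr0n /= mul0rn mul0r ?expr0n /=; ring.
Qed.

(** For [c > 0], order 2 asks that [- c] be a cube, order 3 that [c] be a square, and order 9 forces
    [4 * c] to be a cube. The values of [c] are powers of 2, so 2-adic valuations refute what must
    fail. *)
Lemma all_groups_occur m : m \in [:: 1; 2; 3; 6; 9]%N ->
  exists2 c : rat, c != 0 & torsion_isom (c%:A : K) (cyclic_group m).
Proof.
have nocube (k : int) : k != 0 -> ~~ (3 %| logn 2 `|k|)%N -> forall q : rat, q ^+ 3 != k%:~R.
  by move=> k0 hk q; apply: contra hk => /eqP; apply: rat_power_logn.
have nosq (k : int) : k != 0 -> ~~ (2 %| logn 2 `|k|)%N -> forall q : rat, q ^+ 2 != k%:~R.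
  by move=> k0 hk q; apply: contra hk => /eqP; apply: rat_power_logn.
have noneg (c : rat) : 0 < c -> forall q : rat, q ^+ 2 != - (c *+ 3).
  move=> c0 q; apply: contraTneq c0 => e; rewrite -leNgt -oppr_ge0 -(pmulrn_lge0 _ (isT : 0 < 3)%N).
  by rewrite mulNrn -e sqr_ge0.
have sm (c : rat) : c != 0 -> smooth (c%:A : K) := @rat_smooth K c.
have build := torsion_isom_of_orders p_prime p_ge5 dimK.
rewrite !inE => /or4P[/eqP->|/eqP->|/eqP->|/orP[]/eqP->].
- exists 2%:R => //; apply: (build _ (sm 2%:R isT)) => //=.
  + by apply: no_order2; exact: (nocube (-2) isT isT).
  + by apply: no_order3; [exact: (nosq 2 isT isT) | exact: noneg].
- exists 8%:R => //; apply: (build _ (sm 8%:R isT)) => //=.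
  + exact: (@has_order2 _ _ (- 2%:R)).
  + by apply: no_order3; [exact: (nosq 8 isT isT) | exact: noneg].
- exists 4%:R => //; apply: (build _ (sm 4%:R isT)) => //=.
  + by apply: no_order2; exact: (nocube (-4) isT isT).
  + exact: (@has_order3 _ _ 2%:R).
  + by move=> _; apply: no_order9; exact: (nocube 16 isT isT).
- exists 1 => //; apply: (build _ (sm 1 isT)) => //=.
  + exact: (@has_order2 _ _ (- 1)).
  + exact: (@has_order3 _ _ 1).
- exists 16%:R => //; apply: (build _ (sm 16%:R isT)) => //=.
  + by apply: no_order2; exact: (nocube (-16) isT isT).
  + exact: (@has_order3 _ _ 4%:R).
  + exact: has_order9.
Qed.

End Instances.

Theorem theorem2p2 (p : nat) (p_prime : prime p) (p_ge5 : (5 <= p)%N) :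
  (forall (K : fieldExtType rat) (c : rat),
      \dim {:K} = (3 * p)%N -> c != 0 -> sixth_power_free c ->
      exists2 m : nat, m \in [:: 1; 2; 3; 6; 9]%N &
        torsion_isom (c%:A : K) (cyclic_group m))
  /\
  (forall G : zmodType,
      PhiM (3 * p) G <->
      exists2 m : nat, m \in [:: 1; 2; 3; 6; 9]%N &
        isomorphic G (cyclic_group m)).
Proof.
have tors (K : fieldExtType rat) (c : rat) : \dim {:K} = (3 * p)%N -> c != 0 ->
    exists2 m : nat, m \in [:: 1; 2; 3; 6; 9]%N & torsion_isom (c%:A : K) (cyclic_group m).
  move=> dK /(rat_smooth K) sm; have [m hm [g gm gen]] := torsion_structure sm p_prime p_ge5 dK.
  exists m => //; apply: torsion_isom_cyclic gm gen.
  by move: hm; rewrite !inE => /or4P[/eqP->|/eqP->|/eqP->|/orP[]/eqP->].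
split=> [K c dK c0 _|G]; first exact: tors.
split=> [[K [c [dK c0 hG]]]|[m hm iG]].
  have [m hm hm'] := tors K c dK c0; exists m => //; exact: torsion_isom_unique hG hm'.
have [K [w [dK hw]]] := degree_3p_field p_prime p_ge5.
have [c c0 hc] := all_groups_occur p_prime p_ge5 dK hw hm.
by exists K, c; split=> //; apply: torsion_isom_transfer iG hc.
Qed.
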